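(* Let $q\in\mathbb{C}^\times$ be such that $q^2$ has finite multiplicative order $\ell\geq 4$. For an integer $t\geq 0$ write $t=a\ell+b(t)$ with $a\geq 0$ and $0\leq b(t)\leq \ell-1$, and set $$L_t^{(\ell)}(x)=\sum_{k=0}^\infty \dim\bigl(L_t(t+2k)\bigr)x^k,\qquad W_t(x)=\sum_{k=0}^\infty \dim\bigl(W_t(t+2k)\bigr)x^k ,$$ where $W_t(n)$ and $L_t(n)$ are the cell module and its simple quotient for the Temperley-Lieb algebra $\mathrm{TL}_n(q)$. Let $c(x)=\sum_{n\ge 0}\frac{1}{n+1}\binom{2n}{n}x^n$ and $d(x)=c(x)-1$. Then the following equalities of formal power series hold. If $b(t)=\ell-1$, then $L^{(\ell)}_t(x)=W_t(x)=c(x)^{t+1}$. If $0\leq b(t)\leq \ell-2$, then $$L^{(\ell)}_t(x)=\frac{(d(x)+1)^{t+1}\bigl(1-d(x)^{\ell-1-b(t)}\bigr)}{1-d(x)^\ell}.$$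
   Context: For $n\geq 0$, $\mathrm{TL}_n(q)$ is the associative unital $\mathbb{C}$-algebra with generators $f_1,\dots,f_{n-1}$ and relations $f_i^2=-(q+q^{-1})f_i$, $f_if_{i\pm1}f_i=f_i$, $f_if_j=f_jf_i$ if $|i-j|\geq 2$. Equivalently, it has as basis the planar Temperley-Lieb diagrams from $n$ to $n$. Here a Temperley-Lieb diagram from $t$ to $n$ is a non-crossing pairing (up to isotopy) of $t$ bottom points and $n$ top points; diagrams are composed by stacking, with each closed loop replaced by the scalar $-(q+q^{-1})$, and $f_i$ is the diagram with one cup and one cap at positions $i,i+1$. A diagram $t\to n$ is monic if every bottom point is joined to a top point. For $0\leq t\leq n$ with $t\equiv n \pmod 2$, the cell module $W_t(n)$ has as basis the monic diagrams $t\to n$; $\mathrm{TL}_n(q)$ acts by composition, where non-monic results are set to $0$. In particular $W_0(0)$ is one-dimensional, spanned by the empty diagram. There is a bilinear form on $W_t(n)$ defined on monic diagrams $D_1,D_2$ as follows: with $D^*$ the reflection of $D$ in a horizontal line, if $D_1^*D_2$ is a scalar multiple of the identity diagram $\mathrm{id}_t$, then $D_1^*D_2=(D_1,D_2)\,\mathrm{id}_t$; otherwise $(D_1,D_2)=0$. Its radical $\mathrm{Rad}_t$ is a submodule, and $L_t(n):=W_t(n)/\mathrm{Rad}_t$. *)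

(* Defs.v *)
From HB Require Import structures.
From mathcomp Require Import all_boot all_order all_algebra.
From mathcomp Require Import generic_quotient ring_quotient.
From mathcomp Require Import boolp reals complex zify.

Set Implicit Arguments.
Unset Strict Implicit.
Unset Printing Implicit Defensive.

Import GRing.Theory.
Local Open Scope ring_scope.


Record fps (F : Type) := Fps { fps_coef : nat -> F }.

HB.instance Definition _ F := gen_eqMixin (fps F).
HB.instance Definition _ F := gen_choiceMixin (fps F).

Lemma fpsP F (f g : fps F) : fps_coef f =1 fps_coef g <-> f = g.
Proof.
split=> [|-> //]; case: f g => [f] [g] /= fg.
by congr Fps; apply/funext.
Qed.

Section FpsRing.
Variable F : fieldType.
Implicit Types f g h : fps F.

Definition fps_zero : fps F := Fps (fun=> 0).
Definition fps_opp f := Fps (fun n => - fps_coef f n).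
Definition fps_add f g := Fps (fun n => fps_coef f n + fps_coef g n).
Definition fps_const (a : F) := Fps (fun n => if n == 0%N then a else 0).
Definition fps_mul f g :=
  Fps (fun n => \sum_(i < n.+1) fps_coef f i * fps_coef g (n - i)).

Fact fps_addA : associative fps_add.
Proof. by move=> f g h; apply/fpsP => n /=; rewrite addrA. Qed.
Fact fps_addC : commutative fps_add.
Proof. by move=> f g; apply/fpsP => n /=; rewrite addrC. Qed.
Fact fps_add0 : left_id fps_zero fps_add.
Proof. by move=> f; apply/fpsP => n /=; rewrite add0r. Qed.
Fact fps_addN : left_inverse fps_zero fps_opp fps_add.
Proof. by move=> f; apply/fpsP => n /=; rewrite addNr. Qed.

HB.instance Definition _ :=
  GRing.isZmodule.Build (fps F) fps_addA fps_addC fps_add0 fps_addN.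

Definition fps_trunc n f : {poly F} := \poly_(i < n) fps_coef f i.

Lemma fps_coef_mul n f g i : (i < n)%N ->
  fps_coef (fps_mul f g) i = (fps_trunc n f * fps_trunc n g)`_i.
Proof.
move=> lt_in; rewrite coefM /=; apply: eq_bigr => j _.
rewrite !coef_poly (leq_ltn_trans _ lt_in) ?(leq_ltn_trans (leq_subr _ _) lt_in) //.
by rewrite -ltnS.
Qed.

Fact fps_mulC : commutative fps_mul.
Proof.
by move=> f g; apply/fpsP => n; rewrite !(@fps_coef_mul n.+1) // mulrC.
Qed.
Fact fps_mulA : associative fps_mul.
Proof.
move=> f g h; apply/fpsP => n.
transitivity ((fps_trunc n.+1 f * fps_trunc n.+1 g * fps_trunc n.+1 h)`_n).
  rewrite (@fps_coef_mul n.+1) // -mulrA coefM [RHS]coefM.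
  apply: eq_bigr => j _; congr (_ * _).
  rewrite coef_poly ltnS leq_subr.
  by rewrite (@fps_coef_mul n.+1) // ltnS leq_subr.
rewrite (@fps_coef_mul n.+1) // coefM [RHS]coefM.
apply: eq_bigr => j _; congr (_ * _).
by rewrite coef_poly ltn_ord (@fps_coef_mul n.+1).
Qed.
Fact fps_mul1 : left_id (fps_const 1) fps_mul.
Proof.
move=> f; apply/fpsP => n /=; rewrite big_ord_recl /= mul1r subn0 big1 ?addr0 //.
by move=> i _; rewrite mul0r.
Qed.
Fact fps_mulDl : left_distributive fps_mul fps_add.
Proof.
move=> f g h; apply/fpsP => n /=; rewrite -big_split /=.
by apply: eq_bigr => i _; rewrite mulrDl.
Qed.
Fact fps_1_neq0 : fps_const 1 != 0.
Proof.
apply/eqP => /fpsP /(_ 0%N) /= /eqP; by rewrite (oner_eq0 F).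
Qed.

HB.instance Definition _ := GRing.Zmodule_isComNzRing.Build (fps F)
  fps_mulA fps_mulC fps_mul1 fps_mulDl fps_1_neq0.

Lemma fps_coef0 n : fps_coef (0 : fps F) n = 0. Proof. by []. Qed.
Lemma fps_coef1 n : fps_coef (1 : fps F) n = (n == 0%N)%:R.
Proof. by case: n. Qed.
Lemma fps_coefD f g n : fps_coef (f + g) n = fps_coef f n + fps_coef g n.
Proof. by []. Qed.
Lemma fps_coefN f n : fps_coef (- f) n = - fps_coef f n. Proof. by []. Qed.
Lemma fps_coefM f g n :
  fps_coef (f * g) n = \sum_(i < n.+1) fps_coef f i * fps_coef g (n - i).
Proof. by []. Qed.
Lemma fps_coefM0 f g : fps_coef (f * g) 0 = fps_coef f 0 * fps_coef g 0.
Proof. by rewrite fps_coefM big_ord1. Qed.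
Lemma fps_coef_sum I (r : seq I) (P : pred I) (E : I -> fps F) n :
  fps_coef (\sum_(i <- r | P i) E i) n = \sum_(i <- r | P i) fps_coef (E i) n.
Proof. exact: (big_morph (fun f => fps_coef f n)). Qed.

Lemma fps_coefX_small f k n :
  fps_coef f 0 = 0 -> (n < k)%N -> fps_coef (f ^+ k) n = 0.
Proof.
move=> f0; elim: k n => // k IHk n le_nk.
rewrite exprS fps_coefM big_ord_recl f0 mul0r add0r big1 // => i _.
rewrite IHk ?mulr0 //= /bump /=; have := ltn_ord i; lia.
Qed.

(* Geometric series: if [f = a (1 - u)] with [a] the nonzero constant term of
   [f], then the inverse of [f] is [a^-1 (1 + u + u ^+ 2 + ...)].  *)
Definition fps_unit : pred (fps F) := fun f => fps_coef f 0 != 0.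
Definition fps_inv f : fps F :=
  if fps_coef f 0 == 0 then f else
  let a := fps_coef f 0 in
  let u := 1 - fps_const a^-1 * f in
  fps_const a^-1 * Fps (fun n => \sum_(k < n.+1) fps_coef (u ^+ k) n).

Fact fps_mulVf : {in fps_unit, left_inverse 1 fps_inv *%R}.
Proof.
move=> f; rewrite unfold_in /fps_unit /fps_inv => /[dup] f0 /negPf ->.
set a := fps_coef f 0; set u := 1 - _; set s := Fps _.
have a0 : a != 0 by [].
have fE : fps_const a^-1 * f = 1 - u by rewrite /u subKr.
rewrite mulrAC -mulrA [f * s]mulrC mulrA mulrAC fE mulrC {fE}.
have u0 : fps_coef u 0 = 0.
  by rewrite /u fps_coefD fps_coefN fps_coefM0 /= mulVf ?subrr.
apply/fpsP => n.
have -> : fps_coef (s * (1 - u)) n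
   = fps_coef ((\sum_(k < n.+1) u ^+ k) * (1 - u)) n.
  rewrite !fps_coefM; apply: eq_bigr => i _; congr (_ * _).
  rewrite fps_coef_sum /s /=.
  rewrite (big_ord_widen n.+1 (fun k => fps_coef (u ^+ k) i)) //.
  rewrite [RHS](bigID (fun k : 'I_n.+1 => (k < i.+1)%N)) /=.
  rewrite [X in _ + X]big1 ?addr0 // => k; rewrite -leqNgt => lt_ik.
  exact: fps_coefX_small.
rewrite mulrC; have -> : (1 - u) * (\sum_(k < n.+1) u ^+ k) = 1 - u ^+ n.+1.
  by rewrite -(opprB u) mulNr -subrX1 opprB.
by rewrite fps_coefD fps_coefN fps_coefX_small // subr0.
Qed.

Fact fps_unitPl f g : g * f = 1 -> fps_unit f.
Proof.
move=> /fpsP /(_ 0%N); rewrite fps_coefM0 fps_coef1 /fps_unit => /eqP gf1.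
by apply: contraTneq gf1 => ->; rewrite mulr0 eq_sym oner_eq0.
Qed.

Fact fps_inv_out : {in [predC fps_unit], fps_inv =1 id}.
Proof. by move=> f; rewrite inE negbK /fps_inv => ->. Qed.

HB.instance Definition _ := GRing.ComNzRing_hasMulInverse.Build (fps F)
  fps_mulVf fps_unitPl fps_inv_out.

End FpsRing.


Section VectQuotient.
Variables (K : fieldType) (V : vectType K) (U : {vspace V}).

Definition vquot : Type := Quotient.quot (pred_of_vspace U).
HB.instance Definition _ := GRing.Zmodule.on vquot.
HB.instance Definition _ := EqQuotient.on vquot.

Definition vquot_pi (v : V) : vquot := \pi_vquot%qT v.

Lemma vquot_piP v w : (vquot_pi v == vquot_pi w) = (v - w \in U).
Proof. by rewrite /vquot_pi [RHS]Quotient.idealrBE. Qed.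

Lemma vquot_reprK : cancel (fun x : vquot => repr x : V) vquot_pi.
Proof. exact: reprK. Qed.

Lemma vquot_piD : {morph vquot_pi : v w / v + w}.
Proof. by move=> v w; rewrite /vquot_pi (Quotient.pi_add (pred_of_vspace U)). Qed.

Definition vquot_scale (a : K) (x : vquot) : vquot := vquot_pi (a *: repr x).

Lemma vquot_piZ a v : vquot_pi (a *: v) = vquot_scale a (vquot_pi v).
Proof.
apply/eqP; rewrite vquot_piP -scalerBr memvZ // -vquot_piP.
by rewrite vquot_reprK.
Qed.

Fact vquot_scaleA a b x :
  vquot_scale a (vquot_scale b x) = vquot_scale (a * b) x.
Proof. by rewrite -[x]vquot_reprK -!vquot_piZ scalerA. Qed.
Fact vquot_scale1 : left_id 1 vquot_scale.
Proof. by move=> x; rewrite -[x]vquot_reprK -vquot_piZ scale1r. Qed.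
Fact vquot_scaleDr : right_distributive vquot_scale +%R.
Proof.
move=> a x y; rewrite -[x]vquot_reprK -[y]vquot_reprK.
by rewrite -!(vquot_piD, vquot_piZ) scalerDr.
Qed.
Fact vquot_scaleDl x : {morph vquot_scale^~ x : a b / a + b}.
Proof.
by move=> a b; rewrite -[x]vquot_reprK -!(vquot_piD, vquot_piZ) scalerDl.
Qed.

HB.instance Definition _ := GRing.Zmodule_isLmodule.Build K vquot
  vquot_scaleA vquot_scale1 vquot_scaleDr vquot_scaleDl.

Fact vquot_pi_linear : linear vquot_pi.
Proof. by move=> a v w; rewrite vquot_piD vquot_piZ. Qed.

HB.instance Definition _ :=
  GRing.isLinear.Build K V vquot _ vquot_pi vquot_pi_linear.

Fact vquot_vect_iso : Vector.axiom (\dim U^C) vquot.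
Proof.
have cUU : (U^C :&: U = 0)%VS by rewrite capvC capv_compl.
have UcU v : v \in (U^C + U)%VS by rewrite addvC addv_complf memvf.
pose p v := vsproj U^C%VS (daddv_pi U^C U v).
have vsp v : vsval (p v) = daddv_pi U^C U v by rewrite vsprojK ?memv_pi.
have vp v : v - vsval (p v) \in U.
  by rewrite vsp -{1}(daddv_pi_add cUU (UcU v)) addrC addKr memv_pi.
have peq v w : v - w \in U -> p v = p w.
  move=> vwU; rewrite /p; congr (vsproj _ _); apply/eqP.
  rewrite -subr_eq0 -linearB /= -memv0 -cUU memv_cap memv_pi /=.
  have /(congr1 (fun z => z - daddv_pi U U^C (v - w))) := 
    daddv_pi_add cUU (UcU (v - w)).
  by rewrite addrK => ->; rewrite memvB ?memv_pi.
pose f (x : vquot) := p (repr x).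
have fpi v : f (vquot_pi v) = p v.
  by apply: peq; rewrite -vquot_piP vquot_reprK.
have flin : linear f.
  move=> a x y; rewrite -[x]vquot_reprK -[y]vquot_reprK -linearP !fpi.
  by rewrite /p !linearP.
have fbij : bijective f.
  exists (fun u => vquot_pi (vsval u)) => [x|u].
    by apply/eqP; rewrite -[x in _ == x]vquot_reprK vquot_piP -opprB memvN vp.
  rewrite fpi /p; apply: val_inj => /=.
  by rewrite vsprojK ?memv_pi // daddv_pi_id ?subvsP.
have [g glin gbij] := subvs_vect_iso U^C.
exists (g \o f); last exact: bij_comp.
by move=> a x y /=; rewrite flin glin.
Qed.

HB.instance Definition _ := Lmodule_hasFinDim.Build K vquot vquot_vect_iso.

End VectQuotient.

Lemma dim_vquot (K : fieldType) (V : vectType K) (U : {vspace V}) :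
  (\dim {:vquot U} + \dim U = \dim {:V})%N.
Proof.
rewrite dimvf -[dim (vquot U)]/(\dim U^C)%N.
by rewrite dimv_compl dimvf subnK // -dimvf dimvS ?subvf.
Qed.


(* The [t] bottom points are [inl 0, ..., inl (t-1)] and the [n] top points
   are [inr 0, ..., inr (n-1)], both numbered from left to right.  *)
Definition points (t n : nat) : finType := ('I_t + 'I_n)%type.
Definition pairing (t n : nat) := {ffun points t n -> points t n}.

(* Position of a point along the boundary of the rectangle: the bottom points
   from left to right, then the top points from right to left.  *)
Definition bdry_pos t n (x : points t n) : nat :=
  match x with inl i => i | inr j => t + rev_ord j end.

Definition noncrossing t n (D : pairing t n) : bool :=
  [forall x, forall y,
    ~~ [&& bdry_pos x < bdry_pos y, bdry_pos y < bdry_pos (D x)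
         & bdry_pos (D x) < bdry_pos (D y)]]%N.

Definition TL_diagram t n (D : pairing t n) : bool :=
  [&& [forall x, D (D x) == x], [forall x, D x != x] & noncrossing D].

Definition monic_pairing t n (D : pairing t n) : bool :=
  [forall i : 'I_t, if D (inl i) is inr _ then true else false].

Definition diagram t n := {D : pairing t n | TL_diagram D}.
Definition monic_diagram t n := {D : pairing t n | TL_diagram D && monic_pairing D}.

Definition id_pairing t : pairing t t :=
  [ffun x => match x with inl i => inr i | inr i => inl i end].

Definition flip_point t n (x : points t n) : points n t :=
  match x with inl i => inr i | inr j => inl j end.

(* The reflection [D^*] in a horizontal line.  *)
Definition reflect_pairing t n (D : pairing t n) : pairing n t :=
  [ffun x => flip_point (D (flip_point x))].

Section Stacking.
Variables (t m n : nat) (E : pairing m n) (D : pairing t m).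

(* [E] is stacked on top of [D], the top points of [D] being identified with
   the bottom points of [E].  *)
Definition stack_points : finType := (('I_t + 'I_m) + 'I_n)%type.

Definition of_lower (x : points t m) : stack_points := inl x.
Definition of_upper (y : points m n) : stack_points :=
  match y with inl j => inl (inr j) | inr k => inr k end.
Definition of_outer (x : points t n) : stack_points :=
  match x with inl i => inl (inl i) | inr k => inr k end.

Definition stack_edge : rel stack_points := fun u v =>
  [exists x, (u == of_lower x) && (v == of_lower (D x))]
  || [exists y, (u == of_upper y) && (v == of_upper (E y))].

Definition stack : pairing t n :=
  [ffun x => odflt x [pick y | (y != x)
                             && connect stack_edge (of_outer x) (of_outer y)]].

(* The closed loops are the components which do not reach the boundary.  *)
Definition nb_loops : nat :=
  n_comp stack_edge
    [pred v | ~~ [exists x, connect stack_edge (of_outer x) v]].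

End Stacking.


Section CellModule.
Variables (K : fieldType) (q : K).

Definition loop_value : K := - (q + q^-1).

Definition TL (n : nat) := {ffun diagram n n -> K^o}.

Definition TL_mul n (a b : TL n) : TL n :=
  [ffun F => \sum_E \sum_(D | stack (val E) (val D) == val F)
     a E * b D * loop_value ^+ nb_loops (val E) (val D)].

(* [cell t n] is W_t(n): the coordinates on the basis of monic diagrams. *)
Definition cell (t n : nat) := {ffun monic_diagram t n -> K^o}.

(* As [F] ranges over monic diagrams only, non-monic composites are killed. *)
Definition cell_act t n (a : TL n) (w : cell t n) : cell t n :=
  [ffun F => \sum_E \sum_(D | stack (val E) (val D) == val F)
     a E * w D * loop_value ^+ nb_loops (val E) (val D)].

Variables (t n : nat).

Definition diagram_form (D1 D2 : pairing t n) : K :=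
  if stack (reflect_pairing D1) D2 == id_pairing t
  then loop_value ^+ nb_loops (reflect_pairing D1) D2 else 0.

Definition cell_form (u v : cell t n) : K^o :=
  \sum_D1 \sum_D2 u D1 * v D2 * diagram_form (val D1) (val D2).

Fact cell_form_linear_r u : linear (cell_form u).
Proof.
move=> a v w; rewrite /cell_form scaler_sumr -big_split /=.
apply: eq_bigr => D1 _; rewrite scaler_sumr -big_split /=.
apply: eq_bigr => D2 _; rewrite !ffunE mulrDr mulrDl; congr (_ + _).
by rewrite /GRing.scale /= !mulrA [u D1 * a]mulrC.
Qed.
HB.instance Definition _ u :=
  GRing.isLinear.Build K (cell t n) K^o _ (cell_form u) (cell_form_linear_r u).

Definition cell_form_hom (u : cell t n) : 'Hom(cell t n, K^o) :=
  linfun (cell_form u).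

Fact cell_form_hom_linear : linear cell_form_hom.
Proof.
move=> a u w; apply/lfunP => v; rewrite add_lfunE scale_lfunE !lfunE /=.
rewrite /cell_form scaler_sumr -big_split /=.
apply: eq_bigr => D1 _; rewrite scaler_sumr -big_split /=.
apply: eq_bigr => D2 _; rewrite !ffunE !mulrDl; congr (_ + _).
by rewrite /GRing.scale /= !mulrA.
Qed.
HB.instance Definition _ :=
  GRing.isLinear.Build K (cell t n) 'Hom(cell t n, K^o) _
    cell_form_hom cell_form_hom_linear.

(* The radical is the kernel of [u |-> (v |-> (u, v))].  *)
Definition cell_rad : {vspace cell t n} := lker (linfun cell_form_hom).

Lemma cell_radP (u : cell t n) :
  reflect (forall v, cell_form u v = 0) (u \in cell_rad).
Proof.
rewrite memv_ker lfunE; apply: (iffP eqP) => [/lfunP u0 v | u0].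
  by have := u0 v; rewrite lfunE zero_lfunE.
by apply/lfunP => v; rewrite lfunE zero_lfunE; apply: u0.
Qed.

(* L_t(n) = W_t(n) / Rad_t *)
Definition cell_head := vquot cell_rad.

End CellModule.


Definition cell_series (K : fieldType) (t : nat) : fps rat :=
  Fps (fun k => (\dim {:cell K t (t + 2 * k)})%:R).

Definition cell_head_series (K : fieldType) (q : K) (t : nat) : fps rat :=
  Fps (fun k => (\dim {:cell_head q t (t + 2 * k)})%:R).

Definition catalan_series : fps rat :=
  Fps (fun n => (n.+1%:R)^-1 * 'C(2 * n, n)%:R).

(* Main.v *)
From HB Require Import structures.
Require Import Defs.
From mathcomp Require Import all_boot all_order all_algebra.
From mathcomp Require Import reals complex.
From mathcomp Require Import zify ring.

Set Implicit Arguments.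
Unset Strict Implicit.
Unset Printing Implicit Defensive.
Import GRing.Theory Num.Theory.

(** Write [[k]] for the quantum integers and G(n, t) for the Gram matrix of the
form on W_t(n).  According to whether the last top point of a monic diagram
t -> n+1 is joined to the last bottom point or not, a basis of W_t(n+1) consists
of a basis of W_{t-1}(n) (with a vertical strand added) and of one of W_{t+1}(n)
(with the last bottom strand bent up).  For D : t+1 -> n put

  Phi(D) = [[t+1]] D + sum_i [[i]] D_i,

where D is bent and D_i is D with its i-th and (i+1)-st bottom points joined,
plus a vertical strand.  Capping two adjacent top points commutes with Phi
because of [[k+1]] - [[2]] [[k]] + [[k-1]] = 0, so by induction on n the vector
Phi(D) is orthogonal to W_{t-1}(n), and pairs with the bent basis as -[[t+2]]
times G(n, t+1).  Hence, if [[t+1]] <> 0,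

  rank G(n+1, t) = rank G(n, t-1) + rank G(n, t+1),

the last term being absent if [[t+2]] = 0.  If [[t+1]] = 0 the form is
nondegenerate: over K[X], with X the loop value, the same change of basis gives
a recursion for det G, whence the multiplicity of the root -(q + q^-1) in
det G(n, t) is sum_j dim W_{t+2j}(n) (nu(t+1+j) - nu(j)), nu(k) being its
multiplicity in [[k]].  In characteristic zero nu only depends on whether l
divides k, so this vanishes when l divides t+1.  The theorem follows by
comparing the recursions satisfied by both sides, using c = 1 + x c^2. *)

(** * Noncrossing matchings *)

(* The n top points of a diagram t -> n are numbered 0, ..., n-1 from left to
   right and its t bottom points n, ..., n+t-1 from right to left.  Thus bending
   the last bottom strand up does not change the numbering.  A diagram is a
   function on [nat], of which only the values below n+t matter. *)
Definition skip2 (p x : nat) : nat := if x < p then x else x.+2.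
Definition unskip2 (p x : nat) : nat := if x < p then x else x.-2.

(** With n+1 top points, the arc inserted at p = n joins the last top point to the last bottom
    point: it is a vertical strand at the right edge. For p < n it is a cup. *)
Definition add_arc (p : nat) (m : nat -> nat) (x : nat) : nat :=
  if x == p then p.+1 else if x == p.+1 then p
  else skip2 p (m (unskip2 p x)).

(* If [m p = p.+1] the loop so created is dropped. *)
Definition join_arc (p : nat) (m : nat -> nat) (x : nat) : nat :=
  let y := m (skip2 p x) in
  unskip2 p (if y == p then m p.+1 else if y == p.+1 then m p else y).

Definition eq_below N (m m' : nat -> nat) := forall x, x < N -> m x = m' x.

(* [matching_nest] is the noncrossing condition. *)
Record matching N (m : nat -> nat) : Prop := Matching {
  matching_lt : forall x, x < N -> m x < N;
  matchingK : forall x, x < N -> m (m x) = x;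
  matching_neq : forall x, x < N -> m x <> x;
  matching_nest : forall x y, x < N -> y < N -> x < y < m x -> x < m y < m x }.

(* The diagram is monic: the bottom points go to top points. *)
Definition through n t (m : nat -> nat) := forall x, n <= x < n + t -> m x < n.

Lemma skip2K p : cancel (skip2 p) (unskip2 p).
Proof. by move=> x; rewrite /skip2 /unskip2; case: (ltnP x p); case: ifP; lia. Qed.

Lemma unskip2K p x : x != p -> x != p.+1 -> skip2 p (unskip2 p x) = x.
Proof.
move=> xp xp1; rewrite /skip2 /unskip2.
by case: (ltnP x p) => ?; case: ifP => ?; lia.
Qed.

Lemma skip2_neq p x : (skip2 p x != p) && (skip2 p x != p.+1).
Proof. by rewrite /skip2; case: ltnP; lia. Qed.

Lemma ltn_skip2 p x y : (skip2 p x < skip2 p y) = (x < y).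
Proof. by rewrite /skip2; case: (ltnP x p); case: (ltnP y p); lia. Qed.

Lemma skip2_inj p : injective (skip2 p).
Proof. exact: can_inj (skip2K p). Qed.

Lemma skip2_lt p x N : p <= N -> (skip2 p x < N.+2) = (x < N).
Proof. by move=> pN; rewrite /skip2; case: (ltnP x p) => ?; lia. Qed.

Variant skip2_view p : nat -> Type :=
  | Skip2Fst : skip2_view p p
  | Skip2Snd : skip2_view p p.+1
  | Skip2Skip x : skip2_view p (skip2 p x).

Lemma skip2P p x : skip2_view p x.
Proof.
case: (eqVneq x p) => [->|xp]; first exact: Skip2Fst.
case: (eqVneq x p.+1) => [->|xp1]; first exact: Skip2Snd.
by rewrite -(unskip2K xp xp1); apply: Skip2Skip.
Qed.

Lemma add_arc_fst p m : add_arc p m p = p.+1.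
Proof. by rewrite /add_arc eqxx. Qed.

Lemma add_arc_snd p m : add_arc p m p.+1 = p.
Proof. by rewrite /add_arc eqxx; case: eqP => //; lia. Qed.

Lemma add_arc_skip p m x : add_arc p m (skip2 p x) = skip2 p (m x).
Proof.
by rewrite /add_arc skip2K; have /andP[/negPf-> /negPf->] := skip2_neq p x.
Qed.

Definition add_arcE := (add_arc_fst, add_arc_snd, add_arc_skip).

Lemma add_arc_matching N p m :
  p <= N -> matching N m -> matching N.+2 (add_arc p m).
Proof.
move=> pN [mlt mK mneq mnest]; split.
- move=> x; case: (skip2P p x) => [||z]; rewrite ?add_arcE ?skip2_lt //; try lia.
  exact: mlt.
- move=> x; case: (skip2P p x) => [||z]; rewrite ?add_arcE ?skip2_lt //.
  by move=> zN; rewrite mK.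
- move=> x; case: (skip2P p x) => [||z]; rewrite ?add_arcE ?skip2_lt //; try lia.
  by move=> zN /skip2_inj; apply: mneq.
- move=> x y; case: (skip2P p x) => [||z]; case: (skip2P p y) => [||z'];
    rewrite ?add_arcE ?skip2_lt ?add_arcE ?skip2_lt ?ltn_skip2 ?ltn_skip2 //; try lia.
  - by have := skip2_neq p (m z); have := skip2_neq p z; lia.
  - by have := skip2_neq p (m z); have := skip2_neq p z; lia.
  - exact: mnest.
Qed.

Lemma matching_sym N m x y : matching N m -> x < N -> m x = y -> m y = x.
Proof. by move=> mM xN <-; apply: matchingK mM _ xN. Qed.

Section Join.
Variables (N p : nat) (m : nat -> nat).
Hypotheses (pN : p <= N) (mM : matching N.+2 m).

(** Nothing is lost by [unskip2], as the value chosen is never p or p+1: if z = [skip2 p x] is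
    joined to p, then the partner of p+1 is neither p, whose partner is z, nor p+1. The other case
    is symmetric. *)
Lemma skip2_join x : x < N ->
  skip2 p (join_arc p m x) =
  let y := m (skip2 p x) in
  if y == p then m p.+1 else if y == p.+1 then m p else y.
Proof.
rewrite -(skip2_lt _ pN) /join_arc => xN.
have [pN2 p1N2] : p < N.+2 /\ p.+1 < N.+2 by lia.
have := matching_sym mM xN (erefl _); have := matching_sym mM p1N2 (erefl _).
have := @matching_sym _ _ _ p mM xN; have := @matching_sym _ _ _ p.+1 mM xN.
have := @matching_sym _ _ _ p mM p1N2; have := @matching_sym _ _ _ p.+1 mM pN2.
have := matching_neq mM pN2; have := matching_neq mM p1N2.
have /andP[] := skip2_neq p x.
move: (skip2 p x) xN => z /= *.
by apply: unskip2K; do 2?[case: ifP => ?]; lia.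
Qed.

Lemma join_arc_matching : matching N (join_arc p m).
Proof.
have [pN2 p1N2] : p < N.+2 /\ p.+1 < N.+2 by lia.
have np := matching_neq mM pN2; have np1 := matching_neq mM p1N2.
have lp := matching_lt mM pN2; have lp1 := matching_lt mM p1N2.
have jlt x : x < N -> join_arc p m x < N.
  move=> xN; rewrite -(skip2_lt _ pN) skip2_join //.
  rewrite -(skip2_lt _ pN) in xN; have := matching_lt mM xN.
  by move=> ?; cbv zeta; do 2?[case: ifP => ?]; lia.
split=> //.
- move=> x xN; apply: (@skip2_inj p); rewrite skip2_join ?jlt //.
  rewrite skip2_join //; cbv zeta; have /andP[zp zp1] := skip2_neq p x.
  rewrite -(skip2_lt _ pN) in xN.
  have := matchingK mM xN; have := matching_neq mM xN.
  move: (skip2 p x) zp zp1 xN => z zp zp1 zN nez Kz.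
  case: (eqVneq (m z) p) => [e|nep].
    have e' : m p = z by rewrite -e Kz.
    by rewrite (matchingK mM p1N2) // eqxx e'; case: eqP => ?; lia.
  case: (eqVneq (m z) p.+1) => [e|nep1].
    have e' : m p.+1 = z by rewrite -e Kz.
    by rewrite (matchingK mM pN2) // eqxx e'.
  by rewrite Kz (negPf zp) (negPf zp1).
- move=> x xN /(congr1 (skip2 p)); rewrite skip2_join //; cbv zeta.
  have /andP[zp zp1] := skip2_neq p x.
  rewrite -(skip2_lt _ pN) in xN.
  have := matching_neq mM xN; have := @matching_sym _ _ _ p mM xN.
  have := @matching_sym _ _ _ p.+1 mM xN.
  have := @matching_sym _ _ _ (skip2 p x) mM pN2.
  have := @matching_sym _ _ _ (skip2 p x) mM p1N2.
  move: (skip2 p x) zp zp1 xN => z zp zp1 zN H1 H2 H3 H4 H5.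
  by case: eqP => [e|?]; [|case: eqP => [e|?]]; lia.
(* Nesting is checked in the coordinates of [m], according to whether the partners of x and y are p,
   p+1 or neither. Each case is linear arithmetic from instances of the nesting of [m] at p, p+1 and
   their partners. *)
move=> x y xN yN; rewrite -(ltn_skip2 p x y) -(ltn_skip2 p y) -(ltn_skip2 p x (join_arc _ _ y)).
rewrite -(ltn_skip2 p (join_arc _ _ y)).
rewrite !skip2_join //; cbv zeta.
rewrite -!(skip2_lt _ pN) in xN yN.
have /andP[xp xp1] := skip2_neq p x; have /andP[yp yp1] := skip2_neq p y.
have sym z w (zN : z < N.+2) := @matching_sym _ _ z w mM zN.
have nxy := matching_nest mM xN yN.
have xP : m (skip2 p x) <> skip2 p x by apply: matching_neq mM _ xN.
have yP : m (skip2 p y) <> skip2 p y by apply: matching_neq mM _ yN.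
have xy : m (skip2 p x) = m (skip2 p y) -> skip2 p x = skip2 p y.
  by move=> e; rewrite -(matchingK mM xN) e (matchingK mM yN).
have xS w := sym _ w xN; have yS w := sym _ w yN.
have [pS p1S] := (sym p ^~ pN2, sym p.+1 ^~ p1N2).
have nest z w (zN : z < N.+2) (wN : w < N.+2) := matching_nest mM zN wN.
move: (skip2 p x) (skip2 p y) => u v in xN yN xp xp1 yp yp1 nxy xP yP xy xS yS *.
have ne : (p.+1 == p) = false by lia.
case: (eqVneq (m u) p) => [e|nep].
  have mp := xS _ e; case: (eqVneq (m v) p) => [e'|nvp].
    have := xy (etrans e (esym e')); lia.
  case: (eqVneq (m v) p.+1) => [e'|nvp1].
    by have := yS _ e'; lia.
  have := nest _ _ xN lp1; have := nest _ _ p1N2 yN; have := nest _ _ pN2 p1N2.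
  rewrite (p1S _ erefl) mp; rewrite e in nxy *; lia.
case: (eqVneq (m u) p.+1) => [e|nep1].
  rewrite ?e ?ne; have mp := xS _ e.
  case: (eqVneq (m v) p) => [e'|nvp].
    by have := yS _ e'; lia.
  case: (eqVneq (m v) p.+1) => [e'|nvp1].
    have := xy (etrans e (esym e')); lia.
  have vN : m v < N.+2 by apply: matching_lt mM _ yN.
  have := nest _ _ xN pN2; have := nest _ _ lp vN; have := nest _ _ pN2 yN.
  have := nest _ _ p1N2 vN.
  have := yS u; have := yS (m p).
  rewrite (pS _ erefl) (yS _ erefl) mp; rewrite e in nxy *; lia.
case: (eqVneq (m v) p) => [e|nvp].
  have := nest _ _ xN p1N2; lia.
case: (eqVneq (m v) p.+1) => [e|nvp1]; last exact: nxy.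
have := nest _ _ xN pN2; lia.
Qed.
End Join.

Lemma add_join_arc N p m : p <= N -> matching N.+2 m -> m p = p.+1 ->
  eq_below N.+2 (add_arc p (join_arc p m)) m.
Proof.
move=> pN mM mp; have [pN2 p1N2] : p < N.+2 /\ p.+1 < N.+2 by lia.
have mp1 := matching_sym mM pN2 mp.
move=> x; case: (skip2P p x) => [||z]; rewrite ?add_arcE ?mp ?mp1 //.
move=> zN2; have zN := zN2; rewrite (skip2_lt _ pN) in zN.
rewrite (skip2_join pN mM) //; cbv zeta.
have /andP[] := skip2_neq p z.
have := @matching_sym _ _ _ p mM zN2; have := @matching_sym _ _ _ p.+1 mM zN2.
by case: ifP => [/eqP->|_]; [|case: ifP => [/eqP->|_ //]]; lia.
Qed.

Lemma skip2_eq p x k : k < p -> (skip2 p x == k) = (x == k).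
Proof. by move=> kp; rewrite /skip2; case: ltnP; lia. Qed.

Lemma skip2_small p k : k < p -> skip2 p k = k.
Proof. by rewrite /skip2 => ->. Qed.

Section SkipComm.
Variables (i p : nat).
Hypothesis lt_ip : i.+2 <= p.

Lemma skip2_sub2 : skip2 i p.-2 = p.
Proof. by rewrite /skip2; case: ifP; lia. Qed.

Lemma skip2_sub2S : skip2 i p.-2.+1 = p.+1.
Proof. by rewrite /skip2; case: ifP; lia. Qed.

Lemma skip2C x : skip2 i (skip2 p.-2 x) = skip2 p (skip2 i x).
Proof.
by rewrite /skip2; case: (ltnP x p.-2) => ?; case: (ltnP x i) => ?;
  do 2?[case: ifP => ?]; lia.
Qed.

End SkipComm.

Lemma join_add_comm N i n m : i.+2 <= n -> n <= N.+2 -> matching N.+2 m ->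
  eq_below N.+2 (join_arc i (add_arc n m)) (add_arc n.-2 (join_arc i m)).
Proof.
move=> lt_in nN mM x xN.
have iN : i <= N by lia.
have iN2 : i <= N.+2 by lia.
have S k : k < n -> add_arc n m k = skip2 n (m k).
  by move=> kn; rewrite -{1}(skip2_small kn) add_arcE.
apply: (@skip2_inj i); rewrite (skip2_join iN2 (add_arc_matching nN mM)) //.
case: (skip2P n.-2 x) xN => [||z]; rewrite add_arcE.
- rewrite skip2_sub2 // add_arcE skip2_sub2S //; cbv zeta.
  by do 2?[case: ifP => ?]; lia.
- rewrite skip2_sub2S // add_arcE skip2_sub2 //; cbv zeta.
  by do 2?[case: ifP => ?]; lia.
rewrite skip2_lt; last by lia.
move=> zN; rewrite !skip2C // (skip2_join iN mM) // add_arcE; cbv zeta.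
rewrite !skip2_eq ?S; try lia.
by do 2?case: ifP.
Qed.

(** In the coordinates of [m], both sides follow the strand that starts at z through the caps at i
    and p until it leaves them. The order of capping matters in the computation only if the strand
    runs through both caps. *)
Lemma join_join_comm N i p m : i.+2 <= p -> p <= N.+2 -> matching N.+4 m ->
  eq_below N (join_arc i (join_arc p m)) (join_arc p.-2 (join_arc i m)).
Proof.
move=> lt_ip pN mM x xN.
have iN : i <= N.+2 by lia.
have iN' : i <= N by lia.
have pN' : p.-2 <= N by lia.
have Mp := join_arc_matching pN mM.
have Mi := join_arc_matching iN mM.
apply: (@skip2_inj i); apply: (@skip2_inj p); rewrite -[RHS]skip2C //.
have xi : skip2 i x < N.+2 by rewrite skip2_lt.
have xp : skip2 p.-2 x < N.+2 by rewrite skip2_lt.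
have Jp k : k < N.+2 -> skip2 p (join_arc p m k) =
    let y := m (skip2 p k) in if y == p then m p.+1 else if y == p.+1 then m p else y.
  exact: skip2_join.
have Ji k : k < N.+2 -> skip2 i (join_arc i m k) =
    let y := m (skip2 i k) in if y == i then m i.+1 else if y == i.+1 then m i else y.
  exact: skip2_join.
have eqi y k : k < p -> (y == k) = (skip2 p y == k) by move=> kp; rewrite skip2_eq.
have eqp y : (y == p.-2) = (skip2 i y == p).
  by rewrite -[in RHS](skip2_sub2 lt_ip) (inj_eq (@skip2_inj i)).
have eqp1 y : (y == p.-2.+1) = (skip2 i y == p.+1).
  by rewrite -[in RHS](skip2_sub2S lt_ip) (inj_eq (@skip2_inj i)).
rewrite (skip2_join iN' Mp) // (skip2_join pN' Mi) //; cbv zeta.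
have [ip i1p] : i < p /\ i.+1 < p by lia.
have [iN2 i1N2] : i < N.+2 /\ i.+1 < N.+2 by lia.
have [pN2 p1N2] : p.-2 < N.+2 /\ p.-2.+1 < N.+2 by lia.
have push k b (u v : nat) :
  skip2 k (if b then u else v) = if b then skip2 k u else skip2 k v by case: b.
rewrite (eqi _ _ ip) (eqi _ _ i1p) eqp eqp1.
rewrite (push p) (Jp (skip2 i x)) // (push p _ (join_arc p m i)).
rewrite (push i) (Ji (skip2 p.-2 x)) // (push i _ (join_arc i m p.-2)).
rewrite (Jp i) // (Jp i.+1) // (Jp (skip2 i x)) //.
rewrite (Ji p.-2) // (Ji p.-2.+1) // (Ji (skip2 p.-2 x)) //.
cbv zeta; rewrite !(skip2_sub2 lt_ip) (skip2_sub2S lt_ip) skip2C //.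
rewrite !(skip2_small ip) !(skip2_small i1p).
have zN : skip2 p (skip2 i x) < N.+4 by rewrite !skip2_lt.
have /andP[] := skip2_neq p (skip2 i x).
have : (skip2 p (skip2 i x) != i) && (skip2 p (skip2 i x) != i.+1).
  by rewrite -!eqi ?skip2_neq; lia.
move: (skip2 p (skip2 i x)) zN => z zN /andP[z1 z2] z3 z4.
have [[i4 i14] [p4 p14]] : (i < N.+4 /\ i.+1 < N.+4) /\ (p < N.+4 /\ p.+1 < N.+4) by lia.
have sz k := @matching_sym _ _ _ k mM zN.
have si k := @matching_sym _ _ _ k mM i4.
have si1 k := @matching_sym _ _ _ k mM i14.
have sp k := @matching_sym _ _ _ k mM p4.
have sp1 k := @matching_sym _ _ _ k mM p14.
have [ni ni1] := (matching_neq mM i4, matching_neq mM i14).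
have [np np1] := (matching_neq mM p4, matching_neq mM p14).
have E : (((i == p) = false) * ((i == p.+1) = false) * ((i.+1 == p) = false)
  * ((i.+1 == p.+1) = false) * ((p == i) = false) * ((p.+1 == i) = false)
  * ((p == i.+1) = false) * ((p.+1 == i.+1) = false) * ((i.+1 == i) = false)
  * ((p.+1 == p) = false))%type by do ?split; lia.
(* The cases are the capped point i, i+1, p or p+1 that the strand from z reaches first, if any. *)
case: (eqVneq (m z) i) => [e|zi]; [|case: (eqVneq (m z) i.+1) => [e|zi1]].
- have h1 := sp i; have h2 := sp i.+1; have h3 := sp1 i; have h4 := sp1 i.+1.
  rewrite ?(sz _ e) in h1 h2 h3 h4 *; rewrite ?e ?(sz _ e) ?E ?eqxx ?E ?eqxx.
  move: (m i.+1) (m p) (m p.+1) h1 h2 h3 h4.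
  clear - lt_ip z1 z2 z3 z4 e => a b c h1 h2 h3 h4.
  by case: eqP => ?; [|case: eqP => ?]; do 2?[case: eqP => ?]; lia.
- have h1 := sp i; have h2 := sp i.+1; have h3 := sp1 i; have h4 := sp1 i.+1.
  rewrite ?(sz _ e) in h1 h2 h3 h4 *; rewrite ?e ?(sz _ e) ?E ?eqxx ?E ?eqxx.
  move: (m i) (m p) (m p.+1) h1 h2 h3 h4.
  clear - lt_ip z1 z2 z3 z4 e => a b c h1 h2 h3 h4.
  by case: eqP => ?; [|case: eqP => ?]; do 2?[case: eqP => ?]; lia.
case: (eqVneq (m z) p) => [e|zp]; [|case: (eqVneq (m z) p.+1) => [e|zp1]].
- have h1 := si p; have h2 := si p.+1; have h3 := si1 p; have h4 := si1 p.+1.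
  rewrite ?(sz _ e) in h1 h2 h3 h4 *; rewrite ?e ?(sz _ e) ?E ?eqxx ?E ?eqxx.
  move: (m i) (m i.+1) (m p.+1) h1 h2 h3 h4.
  clear - lt_ip z1 z2 z3 z4 e => a b c h1 h2 h3 h4.
  by case: eqP => ?; [|case: eqP => ?]; do 2?[case: eqP => ?]; lia.
- have h1 := si p; have h2 := si p.+1; have h3 := si1 p; have h4 := si1 p.+1.
  rewrite ?(sz _ e) in h1 h2 h3 h4 *; rewrite ?e ?(sz _ e) ?E ?eqxx ?E ?eqxx.
  move: (m i) (m i.+1) (m p) h1 h2 h3 h4.
  clear - lt_ip z1 z2 z3 z4 e => a b c h1 h2 h3 h4.
  by case: eqP => ?; [|case: eqP => ?]; do 2?[case: eqP => ?]; lia.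
by rewrite /= ?(negPf zi) ?(negPf zi1) ?(negPf zp) ?(negPf zp1).
Qed.

(** Isotopy: an arc at n+1, n+2 followed by a cap at n, n+1 is a zigzag, which straightens. *)
Lemma join_add_zigzag N n m : n < N -> matching N m ->
  eq_below N (join_arc n (add_arc n.+1 m)) m.
Proof.
move=> nN mM x xN; apply: (@skip2_inj n).
have aM : matching N.+2 (add_arc n.+1 m) by apply: add_arc_matching.
rewrite (skip2_join (ltnW nN) aM) //; cbv zeta.
have an : add_arc n.+1 m n = skip2 n.+1 (m n).
  by have := add_arc_skip n.+1 m n; rewrite (@skip2_small n.+1 n).
have [->|xn] := eqVneq x n.
  have -> : skip2 n n = n.+2 by rewrite /skip2 ltnn.
  rewrite add_arcE ifN ?eqxx ?an; last by lia.
  by have := matching_neq mM nN; rewrite /skip2; do 2?[case: ifP => ?]; lia.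
have -> : skip2 n x = skip2 n.+1 x by rewrite /skip2; do 2?[case: ifP => ?]; lia.
rewrite !add_arcE; have [->|mxn] := eqVneq (m x) n.
  by rewrite /skip2 ltnSn ltnn eqxx.
rewrite [skip2 n _]/skip2 [skip2 n.+1 _]/skip2.
case: (ltnP (m x) n) => ?; case: (ltnP (m x) n.+1) => ?; try lia.
  by rewrite !ifN //; lia.
by rewrite !ifN //; lia.
Qed.

(** The zigzag again: p and p+1 being joined, capping p+1 and p+2 hands the partner of p+2 to p,
    which after renumbering amounts to deleting the arc. The next lemma is the mirror image. *)
Lemma join_arc_succ N p m : p.+1 <= N -> matching N.+2 m -> m p = p.+1 ->
  eq_below N (join_arc p.+1 m) (join_arc p m).
Proof.
move=> pN mM mp x xN.
have [pN2 p1N2] : p < N.+2 /\ p.+2 < N.+2 by lia.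
have mp1 := matching_sym mM pN2 mp.
have H : forall z, z < N.+2 -> z != p -> z != p.+1 -> m z <> p /\ m z <> p.+1.
  move=> z zN zp zp1; split=> e; have := matching_sym mM zN e; lia.
rewrite /join_arc; have [->|xp] := eqVneq x p.
  have -> : skip2 p.+1 p = p by rewrite /skip2 ltnSn.
  have -> : skip2 p p = p.+2 by rewrite /skip2 ltnn.
  have [] : m p.+2 <> p /\ m p.+2 <> p.+1 by apply: H; lia.
  move=> y1 y2; have := matching_neq mM p1N2; rewrite mp eqxx /unskip2.
  have -> : (m p.+2 == p) = false by lia.
  have -> : (m p.+2 == p.+1) = false by lia.
  cbv zeta => ?.
  by do 2?[case: ifP => ?]; lia.
have -> : skip2 p.+1 x = skip2 p x by rewrite /skip2; do 2?[case: ifP => ?]; lia.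
have xN2 : skip2 p x < N.+2 by rewrite skip2_lt //; lia.
have /andP[zp zp1] := skip2_neq p x.
have [y1 y2] := H _ xN2 zp zp1; cbv zeta.
have -> : (m (skip2 p x) == p) = false by lia.
have -> : (m (skip2 p x) == p.+1) = false by lia.
rewrite mp1; case: ifP => ?; rewrite /unskip2; do 2?[case: ifP => ?]; lia.
Qed.

Lemma join_arc_pred N p m : p <= N -> 0 < p -> matching N.+2 m -> m p = p.+1 ->
  eq_below N (join_arc p.-1 m) (join_arc p m).
Proof.
case: p => // p pN _ mM mp x xN /=.
have [pN2 p1N2] : p.+1 < N.+2 /\ p < N.+2 by lia.
have mp1 := matching_sym mM pN2 mp.
have H : forall z, z < N.+2 -> z != p.+1 -> z != p.+2 -> m z <> p.+1 /\ m z <> p.+2.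
  move=> z zN zp zp1; split=> e; have := matching_sym mM zN e; lia.
rewrite /join_arc; have [->|xp] := eqVneq x p.
  have -> : skip2 p.+1 p = p by rewrite /skip2 ltnSn.
  have -> : skip2 p p = p.+2 by rewrite /skip2 ltnn.
  have [y1 y2] : m p <> p.+1 /\ m p <> p.+2 by apply: H; lia.
  have := matching_neq mM p1N2; rewrite mp1 /unskip2.
  have -> : (m p == p.+1) = false by lia.
  have -> : (m p == p.+2) = false by lia.
  rewrite eqxx; cbv zeta.
  have -> : (p.+1 == p) = false by lia.
  by move=> ?; do 2?[case: ifP => ?]; lia.
have -> : skip2 p.+1 x = skip2 p x by rewrite /skip2; do 2?[case: ifP => ?]; lia.
have xN2 : skip2 p x < N.+2 by rewrite skip2_lt //; lia.
have /andP[zp zp1] := skip2_neq p x.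
have zp2 : skip2 p x != p.+2 by rewrite /skip2; case: ifP; lia.
have [y1 y2] := H _ xN2 zp1 zp2; cbv zeta.
have -> : (m (skip2 p x) == p.+1) = false by lia.
have -> : (m (skip2 p x) == p.+2) = false by lia.
rewrite mp; case: ifP => ?; rewrite /unskip2; do 2?[case: ifP => ?]; lia.
Qed.

(** * Through strands and innermost cups *)

(** If the last top point n went to a bottom point beyond n+1, the arc would enclose the bottom
    point n+1, whose partner would then be a bottom point as well. If n goes to a smaller top point,
    it can be counted as a bottom point. *)
Lemma through_last n t m : matching (n.+1 + t) m -> through n.+1 t m ->
  (0 < t /\ m n = n.+1) \/ through n t.+1 m.
Proof.
move=> mM thr.
have nN : n < n.+1 + t by lia.
have lt_mn := matching_lt mM nN; have ne_mn := matching_neq mM nN.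
have [mn|nt] := eqVneq (m n) n.+1; first by left; split=> //; lia.
right=> x xt.
have mn : m n < n.
  have [//|] := ltnP (m n) n => mn.
  have n1N : n.+1 < n.+1 + t by lia.
  have := matching_nest mM nN n1N; have := thr n.+1; lia.
have [->//|xn] := eqVneq x n.
have xN : x < n.+1 + t by lia.
have := thr x; have := @matching_sym _ _ _ n mM xN; lia.
Qed.

Lemma through_join_last n t m : matching (n.+1 + t.+1) m ->
  through n.+1 t.+1 m -> m n = n.+1 -> through n t (join_arc n m).
Proof.
move=> mM thr mn x xt.
have nN : n < n.+1 + t.+1 by lia.
have mn1 := matching_sym mM nN mn.
rewrite /join_arc; have -> : skip2 n x = x.+2 by rewrite /skip2 ifN; lia.
have xN : x.+2 < n.+1 + t.+1 by lia.
have := thr x.+2; have := @matching_sym _ _ _ n mM xN.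
rewrite mn => h1 h2.
have -> : (m x.+2 == n) = false by lia.
have -> : (m x.+2 == n.+1) = false by lia.
by rewrite /unskip2 ifT; lia.
Qed.

Lemma innermost_cup n t m : matching (n + t) m -> through n t m ->
  t <= n /\ ((exists2 i, i.+1 < n & m i = i.+1) \/
             (n = t /\ forall x, x < n + t -> m x = (n + t).-1 - x)).
Proof.
elim: n t m => [|n IHn] t m mM thr.
  by case: t mM thr => [|t] mM thr; [split=> //; right; split | have := thr 0; lia].
have [[t_gt0 mn]|thr'] := through_last mM thr; last first.
  have mM' : matching (n + t.+1) m by rewrite addnS.
  have [ltn [[i lt_in mi]|[nt mx]]] := IHn _ _ mM' thr'.
    by split; [lia | left; exists i => //; lia].
  split; first by lia.
  by left; exists n.-1; first lia; rewrite mx; lia.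
case: t t_gt0 mM thr => // t _ mM thr.
have mM2 : matching (n + t).+2 m by move: mM; rewrite addSn addnS.
have nnt : n <= n + t by lia.
have [ltn H] := IHn _ _ (join_arc_matching nnt mM2) (through_join_last mM thr mn).
split; first by lia.
have J x : x < n + t -> skip2 n (join_arc n m x) = m (skip2 n x).
  move=> xN; rewrite (skip2_join nnt mM2) //; cbv zeta.
  have /andP[] := skip2_neq n x.
  have xN2 : skip2 n x < (n + t).+2 by rewrite skip2_lt.
  have nN2 : n < (n + t).+2 by lia.
  have := @matching_sym _ _ _ n mM2 xN2; have := @matching_sym _ _ _ n.+1 mM2 xN2.
  have := matching_sym mM2 nN2 mn; rewrite mn => a b c d e.
  have -> : (m (skip2 n x) == n) = false by lia.
  by have -> : (m (skip2 n x) == n.+1) = false by lia.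
case: H => [[i lt_in ji]|[nt jx]].
  left; exists i; first by lia.
  by have := J i; rewrite ji !(@skip2_small n); lia.
right; split; first by lia.
move=> x; case: (skip2P n x) => [||z].
- by rewrite mn; lia.
- have nN2 : n < (n + t).+2 by lia.
  by rewrite (matching_sym mM2 nN2 mn); lia.
rewrite addSn addnS skip2_lt // => zN; rewrite -J // jx // /skip2.
by do 2?[case: ifP => ?]; lia.
Qed.

(** A bottom point strictly between the two partners would have to go to a top point strictly
    between i and i+1. *)
Lemma nested_partners n t m i : matching (n + t) m -> through n t m ->
  i.+1 < n -> n <= m i -> n <= m i.+1 -> m i = (m i.+1).+1.
Proof.
move=> mM thr lt_in a b.
have [iN i1N] : i < n + t /\ i.+1 < n + t by lia.
have Ki := matchingK mM iN; have Ki1 := matchingK mM i1N.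
have := matching_lt mM iN; have := matching_lt mM i1N => c d.
have [//|ne] := eqVneq (m i) (m i.+1).+1.
have zN : (m i.+1).+1 < n + t by have := matching_nest mM iN i1N; lia.
have zlt := matching_lt mM zN; have Kz := matchingK mM zN.
have := matching_nest mM iN zN; have := matching_nest mM i1N iN.
have := thr (m i.+1).+1.
have := matching_nest mM i1N zlt.
have := matching_nest mM iN zlt.
have := @matching_sym _ _ _ i mM zN; have := @matching_sym _ _ _ i.+1 mM zN.
have := matching_nest mM zlt iN; have := matching_nest mM zlt i1N.
have := matching_nest mM iN i1N.
rewrite Kz; lia.
Qed.

(* [ballot n s] is the dimension of W_t(n) for s = t+1; the shift lets the
   recursion hold at t = 0, with [ballot n 0 = 0]. *)
Fixpoint ballot (n s : nat) : nat :=
  match n, s with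
  | 0, s => (s == 1)
  | n.+1, 0 => 0
  | n.+1, s.+1 => ballot n s + ballot n s.+2
  end.

Lemma ballot0 n : ballot n 0 = 0. Proof. by case: n. Qed.

Lemma ballot0_void n : 'I_(ballot n 0) -> False.
Proof. by rewrite ballot0 => -[]. Qed.

(* The left summand adds a vertical strand, the right one bends a strand up. *)
Fixpoint walk_matching (n s : nat) : 'I_(ballot n s) -> nat -> nat :=
  match n, s with
  | n.+1, s.+1 => fun j => match split j with
                  | inl k => add_arc n (@walk_matching n s k)
                  | inr k => @walk_matching n s.+2 k
                  end
  | _, _ => fun _ x => x
  end.

Lemma walk_matching_lshift n s (k : 'I_(ballot n s)) :
  @walk_matching n.+1 s.+1 (lshift (ballot n s.+2) k) = add_arc n (walk_matching k).
Proof. by rewrite /= (unsplitK (inl k)). Qed.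

Lemma walk_matching_rshift n s (k : 'I_(ballot n s.+2)) :
  @walk_matching n.+1 s.+1 (rshift (ballot n s) k) = walk_matching k.
Proof. by rewrite /= (unsplitK (inr k)). Qed.

Lemma walk_split n s (j : 'I_(ballot n.+1 s.+1)) :
  {k : 'I_(ballot n s) | j = lshift (ballot n s.+2) k} +
  {k : 'I_(ballot n s.+2) | j = rshift (ballot n s) k}.
Proof.
case: (splitP j) => k jk; [left | right]; exists k; exact: val_inj.
Qed.

Lemma walk_matchingP n t (j : 'I_(ballot n t.+1)) :
  matching (n + t) (walk_matching j) /\ through n t (walk_matching j).
Proof.
elim: n t j => [|n IHn] t j.
  case: t j => [|t] [j jlt]; last by have := jlt; rewrite ltn0.
  by split; [split | move=> x; lia].
case: (walk_split j) => -[k ->].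
  rewrite walk_matching_lshift; case: t k {j} => [|t] k.
    by have := ballot0_void k.
  have [kM kthr] := IHn _ k; split.
    by rewrite addSnnS 2!addnS; apply: add_arc_matching => //; lia.
  move=> x; case: (skip2P n x) => [||z]; rewrite add_arcE; try lia.
  have := kthr z; rewrite /skip2; case: (ltnP z n) => ?; first lia.
  by case: ifP; lia.
rewrite walk_matching_rshift.
have [kM kthr] := IHn _ k; split; first by rewrite addSnnS.
by move=> x xt; have := kthr x; lia.
Qed.

(** The two cases of [through_last] are the two summands in the recursion for [ballot]. *)
Lemma walk_matching_surj n t m : matching (n + t) m -> through n t m ->
  exists j : 'I_(ballot n t.+1), eq_below (n + t) (walk_matching j) m.
Proof.
elim: n t m => [|n IHn] t m mM thr.
  case: t mM thr => [|t] mM thr; last by have := thr 0; lia.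
  by exists ord0 => x; rewrite addn0.
have [[t_gt0 mn]|thr'] := through_last mM thr; last first.
  have [||k km] := IHn t.+1 m; rewrite ?addnS //.
  exists (rshift (ballot n t) k); rewrite walk_matching_rshift => x xN.
  by apply: km; lia.
case: t t_gt0 mM thr => // t _ mM thr.
have thr' := through_join_last mM thr mn.
have mM2 : matching (n + t).+2 m by move: mM; rewrite addSn addnS.
have nnt : n <= n + t by lia.
have [k km] := IHn _ _ (join_arc_matching nnt mM2) thr'.
exists (lshift (ballot n t.+3) k); rewrite walk_matching_lshift.
rewrite addSn addnS => x xN; rewrite -[RHS](add_join_arc nnt mM2 mn) //.
case: (skip2P n x) xN => [||z]; rewrite !add_arcE // skip2_lt // => zN.
by rewrite km.
Qed.

Lemma walk_matching_inj n t (j j' : 'I_(ballot n t.+1)) :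
  eq_below (n + t) (walk_matching j) (walk_matching j') -> j = j'.
Proof.
elim: n t j j' => [|n IHn] t j j' E.
  case: t j j' E => [|t] [j jlt] [j' jlt']; last by have := jlt; rewrite ltn0.
  by move=> _; apply: val_inj => /=; move: jlt jlt' => /=; lia.
have nN : n < n.+1 + t by lia.
case: (walk_split j) => -[k jE]; case: (walk_split j') => -[k' jE'].
- rewrite jE jE'; congr lshift; rewrite jE jE' !walk_matching_lshift in E.
  case: t k k' E {nN j j' jE jE'} => [|t] k k' E.
    by have := ballot0_void k.
  apply: IHn => x xN; apply: (@skip2_inj n).
  by rewrite -!add_arc_skip E // addSn addnS skip2_lt //; lia.
- have := E _ nN; rewrite jE jE' walk_matching_lshift walk_matching_rshift.
  by rewrite add_arcE; have [_ /(_ n)] := walk_matchingP k'; lia.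
- have := E _ nN; rewrite jE jE' walk_matching_lshift walk_matching_rshift.
  by rewrite add_arcE; have [_ /(_ n)] := walk_matchingP k; lia.
rewrite jE jE'; congr rshift; apply: IHn => x xN.
by rewrite -!walk_matching_rshift -jE -jE' E //; lia.
Qed.

(** * Gluing two diagrams *)

Section GlueGraph.
Variables (t n : nat).
Implicit Types (D E : pairing t n) (x y : points t n).

(** [lower_pt] places the points of the lower diagram D, and [upper_pt] those of E turned upside
    down on top of it. The n middle points are common to both. *)
Definition lower_pt x : stack_points t n t := inl x.
Definition upper_pt x : stack_points t n t :=
  match x with inl a => inr a | inr j => inl (inr j) end.

Definition glue E D := stack_edge (reflect_pairing E) D.

Lemma glueP E D u v :
  reflect ((exists2 x, u = lower_pt x & v = lower_pt (D x)) \/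
           (exists2 x, u = upper_pt x & v = upper_pt (E x))) (glue E D u v).
Proof.
have upE (x : points n t) : of_upper t x = upper_pt (flip_point x).
  by case: x.
apply: (iffP orP) => -[].
- by case/existsP=> x /andP[/eqP-> /eqP->]; left; exists x.
- case/existsP=> x /andP[/eqP-> /eqP->]; right; exists (flip_point x) => //.
  by rewrite upE ffunE; case: (E _).
- by case=> x -> ->; left; apply/existsP; exists x; rewrite !eqxx.
- case=> x -> ->; right; apply/existsP; exists (flip_point x).
  rewrite !upE ffunE; case: x => x /=; rewrite eqxx /=; case: (E _) => //=.
Qed.

Lemma glue_sym E D : involutive E -> involutive D -> symmetric (glue E D).
Proof.
move=> Ei Di; suff H u v : glue E D u v -> glue E D v u.
  by move=> u v; apply/idP/idP; apply: H.
case/glueP=> -[x -> ->]; apply/glueP; [left; exists (D x)|right; exists (E x)] => //.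
  by rewrite Di.
by rewrite Ei.
Qed.

End GlueGraph.

(* [E1] is [E] with a cup added at the top points [ti], [ti1], and [D'] is [D]
   with these two points capped; [sk] numbers the other top points. *)
Section Contract.
Variables (t n : nat) (ti ti1 : 'I_n.+2) (sk : 'I_n -> 'I_n.+2).
Hypothesis sk_inj : injective sk.
Hypothesis sk_neq : forall j, (sk j != ti) && (sk j != ti1).
Hypothesis sk_cover : forall k, k != ti -> k != ti1 -> exists j, k = sk j.

Definition lift_pt (x : points t n) : points t n.+2 :=
  match x with inl a => inl a | inr j => inr (sk j) end.
Definition lift_stack (v : stack_points t n t) : stack_points t n.+2 t :=
  match v with
  | inl (inl a) => inl (inl a) | inl (inr j) => inl (inr (sk j)) | inr a => inr a
  end.

Variables (E D' : pairing t n) (E1 D : pairing t n.+2).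
Hypotheses (Ei : involutive E) (Di' : involutive D').
Hypotheses (E1i : involutive E1) (Di : involutive D) (Dn : forall x, D x != x).
Hypothesis ti_neq : (ti1 == ti) = false.
Hypothesis E1ti : E1 (inr ti) = inr ti1.
Hypothesis E1ti1 : E1 (inr ti1) = inr ti.
Hypothesis E1sk : forall x, E1 (lift_pt x) = lift_pt (E x).
Hypothesis D'sk : forall x, lift_pt (D' x) =
  if D (lift_pt x) == inr ti then D (inr ti1)
  else if D (lift_pt x) == inr ti1 then D (inr ti) else D (lift_pt x).

Local Notation G := (glue E1 D).
Local Notation G' := (glue E D').
Let symG : connect_sym G. Proof. exact/sym_connect_sym/glue_sym. Qed.
Let symG' : connect_sym G'. Proof. exact/sym_connect_sym/glue_sym. Qed.

Local Notation mid k := (lower_pt (inr k : points t n.+2)).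

Lemma lift_pt_inj : injective lift_pt.
Proof. by move=> [a|j] [b|k] //= [] => [->|/sk_inj->]. Qed.

Lemma lift_pt_neq x : (lift_pt x != inr ti) && (lift_pt x != inr ti1).
Proof. by case: x => [a|j] //=; exact: sk_neq. Qed.

Lemma lift_pt_cover y : y != inr ti -> y != inr ti1 -> exists x, y = lift_pt x.
Proof.
case: y => [a|k] h h1; first by exists (inl a).
by have [j ->] := sk_cover h h1; exists (inr j).
Qed.

Lemma lift_lower x : lift_stack (lower_pt x) = lower_pt (lift_pt x).
Proof. by case: x. Qed.

Lemma lift_upper x : lift_stack (upper_pt x) = upper_pt (lift_pt x).
Proof. by case: x. Qed.

Lemma upper_mid k : upper_pt (inr k : points t n.+2) = mid k.
Proof. by []. Qed.

Lemma lift_stack_inj : injective lift_stack.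
Proof. by move=> [[a|j]|a] [[b|k]|b] //= [] => [->|/sk_inj->|->]. Qed.

Lemma outer_lift a : of_outer n.+2 a = lift_stack (of_outer n a).
Proof. by case: a. Qed.

Let loops := [pred v | ~~ [exists x, connect G (of_outer n.+2 x) v]].

Lemma loops_closed : closed G loops.
Proof.
move=> u v uv; rewrite !inE; congr (~~ _).
by apply/eq_existsb => x; exact: same_connect1r.
Qed.

(** The adjunction makes the components of the small graph correspond to those of the large one
    inside [A]. Outer points correspond to outer points, so the stacked pairings agree and so do the
    loops inside [A]. Below, [A] is everything, or all but the closed loop. *)
Lemma form_contract (A : {pred stack_points t n.+2 t}) : closed G A ->
  (forall v, lift_stack v \in A) ->
  rel_adjunction lift_stack G G' A ->
  stack (reflect_pairing E1) D = stack (reflect_pairing E) D' /\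
  n_comp G [predI loops & A] = nb_loops (reflect_pairing E) D'.
Proof.
move=> clA liftA [unitA functA]; split.
  apply/ffunP => x; rewrite !ffunE; congr odflt; apply: eq_pick => y.
  congr (_ && _).
  by rewrite !outer_lift [RHS]functA.
have clLA : closed G [predI loops & A].
  move=> u v uv; rewrite !inE (clA _ _ uv); congr (_ && _).
  exact: (loops_closed uv).
have adj : rel_adjunction lift_stack G G' [predI loops & A].
  by split=> [x /andP[_ xA]|x y /andP[_ xA]]; [exact: unitA | exact: functA].
rewrite (adjunction_n_comp lift_stack symG symG' clLA adj); apply: eq_n_comp_r => v.
rewrite !inE liftA andbT; congr (~~ _); apply/eq_existsb => x.
by rewrite outer_lift functA.
Qed.

Lemma contract_noloop : D (inr ti) != inr ti1 ->
  stack (reflect_pairing E1) D = stack (reflect_pairing E) D' /\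
  nb_loops (reflect_pairing E1) D = nb_loops (reflect_pairing E) D'.
Proof.
move=> noloop.
have noloop1 : D (inr ti1) != inr ti.
  by apply: contraNneq noloop => <-; rewrite Di.
have [a Da] := lift_pt_cover (Dn _) noloop.
have [b Db] := lift_pt_cover noloop1 (Dn _).
have aD : D (lift_pt a) = inr ti by rewrite -Da Di.
have bD : D (lift_pt b) = inr ti1 by rewrite -Db Di.
have a_b : (a == b) = false.
  by apply/negbTE/eqP => e; move: aD; rewrite e bD => -[/eqP]; rewrite ti_neq.
have D'a : D' a = b.
  by apply: lift_pt_inj; rewrite D'sk aD eqxx.
have D'b : D' b = a by rewrite -D'a Di'.
(* A map back to the small graph: the capped points go to their partners a and b under D, which D'
   joins to each other. By [sk_cover] the default of [odflt] is never reached. *)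
pose h' (v : stack_points t n.+2 t) : stack_points t n t :=
  match v with
  | inl (inl c) => inl (inl c)
  | inr c => inr c
  | inl (inr k) => if k == ti then lower_pt a else if k == ti1 then lower_pt b
      else odflt (lower_pt a) (omap (fun j => inl (inr j)) [pick j | sk j == k])
  end.
have h'lift v : h' (lift_stack v) = v.
  case: v => [[c|j]|c] //=; have /andP[/negPf-> /negPf->] := sk_neq j.
  by case: pickP => [j' /eqP/sk_inj->|/(_ j)]; rewrite ?eqxx.
have h'ti : h' (mid ti) = lower_pt a by rewrite /= eqxx.
have h'ti1 : h' (mid ti1) = lower_pt b by rewrite /= ti_neq eqxx.
have adj : rel_adjunction lift_stack G G' predT.
  have GL x : G (lower_pt x) (lower_pt (D x)) by apply/glueP; left; exists x.
  have GU x : G (upper_pt x) (upper_pt (E1 x)) by apply/glueP; right; exists x.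
  have GL' x : G' (lower_pt x) (lower_pt (D' x)) by apply/glueP; left; exists x.
  have GU' x : G' (upper_pt x) (upper_pt (E x)) by apply/glueP; right; exists x.
  apply: (@intro_adjunction _ _ lift_stack _ _ symG' predT _ (fun x _ => h' x)) => // [v _|v' _].
    split=> [|w _ /glueP[] [x -> ->]].
    - case: v => [[c|k]|c]; [exact: connect0 | rewrite [h' _]/= | exact: connect0].
      have [->|kti] := eqVneq k ti.
        by rewrite lift_lower -Da; apply/connect1/GL.
      have [->|kti1] := eqVneq k ti1; first by rewrite lift_lower -Db; apply/connect1/GL.
      have [j ->] := sk_cover kti kti1; case: pickP => [j' /eqP/sk_inj-> //|/(_ j)].
      by rewrite eqxx.
    - have [->|xti] := eqVneq x (inr ti); first by rewrite Da h'ti -lift_lower h'lift.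
      have [->|xti1] := eqVneq x (inr ti1); first by rewrite Db h'ti1 -lift_lower h'lift.
      have [y ey] := lift_pt_cover xti xti1; rewrite ey -lift_lower h'lift.
      have [e|nti] := eqVneq (D (lift_pt y)) (inr ti).
        rewrite e h'ti; suff -> : y = a by [].
        by apply: lift_pt_inj; rewrite -Da -e Di.
      have [e|nti1] := eqVneq (D (lift_pt y)) (inr ti1).
        rewrite e h'ti1; suff -> : y = b by [].
        by apply: lift_pt_inj; rewrite -Db -e Di.
      have <- : lift_pt (D' y) = D (lift_pt y) by rewrite D'sk (negPf nti) (negPf nti1).
      by rewrite -lift_lower h'lift; apply/connect1/GL'.
    have [->|xti] := eqVneq x (inr ti).
      by rewrite E1ti !upper_mid h'ti h'ti1 -D'a; apply/connect1/GL'.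
    have [->|xti1] := eqVneq x (inr ti1).
      by rewrite E1ti1 !upper_mid h'ti h'ti1 -D'b; apply/connect1/GL'.
    have [y ey] := lift_pt_cover xti xti1.
    by rewrite ey E1sk -!lift_upper !h'lift; apply/connect1/GU'.
  split=> [|w' /glueP[] [x -> ->]]; first by rewrite h'lift.
    have e1 : connect G (mid ti) (mid ti1).
      by apply: connect1; have := GU (inr ti); rewrite E1ti.
    have ea : connect G (lower_pt (lift_pt a)) (mid ti) by rewrite -aD; apply/connect1/GL.
    have eb : connect G (lower_pt (lift_pt b)) (mid ti1) by rewrite -bD; apply/connect1/GL.
    rewrite !lift_lower.
    have [->|xa] := eqVneq x a.
      by rewrite D'a (connect_trans ea) // (connect_trans e1) // symG.
    have [->|xb] := eqVneq x b.
      by rewrite D'b (connect_trans eb) // symG (connect_trans ea).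
    rewrite D'sk ifN ?ifN; first exact/connect1/GL.
      by apply: contraNneq xb => e; apply/eqP/lift_pt_inj; rewrite -Db -e Di.
    by apply: contraNneq xa => e; apply/eqP/lift_pt_inj; rewrite -Da -e Di.
  by rewrite !lift_upper -E1sk; apply/connect1/GU.
have [|//|eq_stack eq_loops] := form_contract (A := predT) _ _ adj => //.
split=> //; rewrite -eq_loops; apply: eq_n_comp_r => v.
by rewrite !inE andbT.
Qed.

Lemma contract_loop : D (inr ti) = inr ti1 ->
  stack (reflect_pairing E1) D = stack (reflect_pairing E) D' /\
  nb_loops (reflect_pairing E1) D = (nb_loops (reflect_pairing E) D').+1.
Proof.
move=> Dti; have Dti1 : D (inr ti1) = inr ti by rewrite -Dti Di.
have D'E x : lift_pt (D' x) = D (lift_pt x).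
  have /andP[x1 x2] := lift_pt_neq x.
  rewrite D'sk ifN ?ifN //.
    by apply: contraNneq x1 => e; rewrite -[lift_pt x]Di e Dti1.
  by apply: contraNneq x2 => e; rewrite -[lift_pt x]Di e Dti.
(* The loop consists of the two capped points only, and away from it the two graphs are
   isomorphic. *)
pose A := [pred v | (v != mid ti) && (v != mid ti1)].
have Alift v : lift_stack v \in A.
  rewrite inE; case: v => [[c|j]|c] //=.
  exact: sk_neq.
have step u v : G u v -> (u \in pred2 (mid ti) (mid ti1)) ->
    v \in pred2 (mid ti) (mid ti1).
  case/glueP=> -[x -> ->].
    rewrite !inE /lower_pt !(inj_eq (@inl_inj _ _)).
    by case/pred2P=> ->; rewrite ?Dti ?Dti1 eqxx ?orbT.
  case: x => [c|k]; first by rewrite inE.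
  by case/pred2P=> -[->]; rewrite ?E1ti ?E1ti1 !inE eqxx ?orbT.
have clA : closed G A.
  apply: intro_closed => // u v uv; rewrite !inE -!negb_or.
  apply: contra => vA; have := step v u; rewrite !inE; apply => //.
  by rewrite glue_sym.
have adj : rel_adjunction lift_stack G G' A.
  apply: strict_adjunction => //; first exact: lift_stack_inj.
    apply/subsetP => v; rewrite inE => /andP[v1 v2]; apply/codomP.
    case: v v1 v2 => [[c|k]|c] v1 v2; [by exists (inl (inl c)) | | by exists (inr c)].
    have [||j ->] := @sk_cover k; [by apply: contraNneq v1 => -> | by apply: contraNneq v2 => -> |].
    by exists (inl (inr j)).
  move=> u v _; apply/glueP/glueP => -[] [x eu ev].
  - have := Alift u; rewrite eu inE => /andP[x1 x2].
    have [||y ey] := @lift_pt_cover x.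
    + by apply: contraNneq x1 => ->.
    + by apply: contraNneq x2 => ->.
    by left; exists y; apply: lift_stack_inj; rewrite lift_lower ?D'E -ey.
  - have := Alift u; rewrite eu inE => /andP[x1 x2].
    have [||y ey] := @lift_pt_cover x.
    + by apply: contraNneq x1 => ->.
    + by apply: contraNneq x2 => ->.
    by right; exists y; apply: lift_stack_inj; rewrite lift_upper -?E1sk -ey.
  - by left; exists (lift_pt x); rewrite ?eu ?ev lift_lower ?D'E.
  - by right; exists (lift_pt x); rewrite ?eu ?ev lift_upper ?E1sk.
have [//|//|eq_stack eq_loops] := form_contract _ _ adj => //.
split=> //; rewrite -eq_loops.
have -> : nb_loops (reflect_pairing E1) D = n_comp G loops by [].
(* The loops are counted inside and outside [A]. Outside there is a single component, and it does
   not reach the boundary. *)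
rewrite /n_comp_mem -(cardID A) -[RHS]addn1; congr (_ + _)%N.
  by apply: eq_card => v; rewrite !inE -andbA.
rewrite -(n_comp_connect symG (mid ti)); apply: eq_card => v.
rewrite !inE andbCA; congr (_ && _).
have clA' : closed G [predC A] := predC_closed clA.
have ccA := closed_connect clA'.
apply/andP/idP => [[vA _]|tv].
  move: vA; rewrite negb_and !negbK => /orP[]/eqP->; first exact: connect0.
  by apply: connect1; apply/glueP; left; exists (inr ti); rewrite ?Dti.
have vA : v \notin A.
  by have := ccA _ _ tv; rewrite !inE eqxx /= => <-.
split; first by move: vA; rewrite !inE.
apply/existsPn => x; apply: contra vA => xv.
have := ccA _ _ xv; rewrite outer_lift !inE.
by have := Alift (of_outer n x); rewrite !inE => -> /=; case: (_ && _).
Qed.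
End Contract.

(** * From numbered matchings to diagrams *)

Definition pos t n (x : points t n) : nat :=
  match x with inl a => n + rev_ord a | inr j => j end.

(** For a matching the default [x] is never taken, since every number below n+t is the position of a
    point. *)
Definition pairing_of t n (m : nat -> nat) : pairing t n :=
  [ffun x => odflt x [pick y | pos y == m (pos x)]].

Section Pos.
Variables t n : nat.
Implicit Types (x y : points t n) (m : nat -> nat).

Lemma pos_lt x : pos x < n + t.
Proof. by case: x => [a|j] /=; [have := ltn_ord a | have := ltn_ord j]; lia. Qed.

Lemma pos_inj : injective (@pos t n).
Proof.
move=> [a|j] [b|k] /= e.
- by congr inl; apply/ord_inj; have := ltn_ord a; have := ltn_ord b; lia.
- by have := ltn_ord k; lia.
- by have := ltn_ord j; lia.
- by congr inr; apply/ord_inj.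
Qed.

Lemma pos_surj k : k < n + t -> exists x, pos x = k.
Proof.
move=> kN; have [kn|nk] := ltnP k n; first by exists (inr (Ordinal kn)).
have kt : k - n < t by lia.
by exists (inl (rev_ord (Ordinal kt))); rewrite /pos rev_ordK /=; lia.
Qed.

Lemma pos_pairing_of m x : matching (n + t) m -> pos (pairing_of t n m x) = m (pos x).
Proof.
move=> mM; rewrite ffunE; case: pickP => [y /eqP //|none].
have [y yE] := pos_surj (matching_lt mM (pos_lt x)).
by have := none y; rewrite yE eqxx.
Qed.

Lemma eq_pairing_of m m' : eq_below (n + t) m m' -> pairing_of t n m = pairing_of t n m'.
Proof. by move=> E; apply/ffunP => x; rewrite !ffunE E ?pos_lt. Qed.

Lemma pairing_of_inj m m' : matching (n + t) m -> matching (n + t) m' ->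
  pairing_of t n m = pairing_of t n m' -> eq_below (n + t) m m'.
Proof.
by move=> mM mM' E k /pos_surj[x <-]; rewrite -!pos_pairing_of ?E.
Qed.

Lemma pairing_of_involutive m : matching (n + t) m -> involutive (pairing_of t n m).
Proof.
move=> mM x; apply: pos_inj; rewrite !pos_pairing_of //.
by rewrite (matchingK mM) // pos_lt.
Qed.

Lemma pairing_of_neq m x : matching (n + t) m -> pairing_of t n m x != x.
Proof.
move=> mM; rewrite -(inj_eq pos_inj) pos_pairing_of //.
by apply/eqP; apply: matching_neq mM _ (pos_lt x).
Qed.
End Pos.

Local Open Scope ring_scope.

(** This is [diagram_form] with a free loop value, so that the form at -(q + q^-1) is a
    specialisation of the one over K[X]. *)
Definition glue_form (R : pzSemiRingType) (delta : R) t n (D1 D2 : pairing t n) : R :=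
  if stack (reflect_pairing D1) D2 == id_pairing t
  then delta ^+ nb_loops (reflect_pairing D1) D2 else 0.

Definition gram (R : pzSemiRingType) (delta : R) n t (m m' : nat -> nat) : R :=
  glue_form delta (pairing_of t n m) (pairing_of t n m').

Section Glue.
Variables (t n : nat).
Implicit Types D E : pairing t n.

Definition mirror_stack (v : stack_points t n t) : stack_points t n t :=
  match v with
  | inl (inl a) => inr a | inl (inr j) => inl (inr j) | inr a => inl (inl a)
  end.

(* [stack] picks the first other endpoint of a component.  If all picks are as
   in the identity, a component has at most two endpoints: every endpoint but
   the first one [f] is sent to [f]. *)
Lemma glue_idP E D : involutive E -> involutive D ->
  reflect (forall x y : points t t, connect (glue E D) (of_outer n x) (of_outer n y) =
             (y == x) || (y == flip_point x))
    (stack (reflect_pairing E) D == id_pairing t).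
Proof.
move=> Ei Di; have sym := sym_connect_sym (glue_sym Ei Di).
have idE (x : points t t) : id_pairing t x = flip_point x by rewrite ffunE; case: x.
have flip_neq (x : points t t) : (flip_point x == x) = false by case: x.
apply: (iffP eqP) => [stackE x y|H].
  have stk z : odflt z [pick w | (w != z) && connect (glue E D) (of_outer n z) (of_outer n w)]
      = flip_point z.
    by rewrite -idE -stackE ffunE.
  pose S := [pred w | connect (glue E D) (of_outer n x) (of_outer n w)].
  have stkS z : z \in S -> connect (glue E D) (of_outer n x) (of_outer n (flip_point z)).
    move=> zS; have := stk z; case: pickP => [w /andP[_ zw] /= <-|_ /= e].
      exact: connect_trans zS zw.
    by have := flip_neq z; rewrite -e eqxx.
  have [f fE] : exists f, forall z, z \in S -> z != f -> flip_point z = f.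
    have : x \in enum S by rewrite mem_enum inE connect0.
    case eS : (enum S) => [//|f s] _; exists f => z zS zf.
    rewrite -stk /pick /enum_mem.
    have -> : [seq w <- Finite.enum (points t t) |
        [pred w | (w != z) && connect (glue E D) (of_outer n z) (of_outer n w)] w] =
        [seq w <- enum S | w != z].
      rewrite /enum_mem -filter_predI; apply: eq_filter => w /=.
      by rewrite inE; congr (_ && _); rewrite !inE in zS *; rewrite (same_connect sym zS).
    by rewrite eS /= eq_sym zf.
  have xS : x \in S by rewrite inE connect0.
  apply/idP/orP => [xy|[/eqP->|/eqP->]]; [|exact: connect0 | exact: stkS].
  have fK : involutive (@flip_point t t) by case.
  have [xf|xf] := eqVneq x f.
    have [->|yf] := eqVneq y f; first by left; rewrite xf.
    by right; apply/eqP; rewrite xf -(fE y) // fK.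
  have [->|yf] := eqVneq y f; first by right; rewrite (fE x).
  by left; apply/eqP; rewrite -[y]fK (fE y) // -(fE x) ?fK.
apply/ffunP => x; rewrite idE ffunE; case: pickP => [y /andP[yx]|/(_ (flip_point x))].
  by rewrite H (negPf yx) /= => /eqP.
by rewrite H eqxx orbT andbT flip_neq.
Qed.

Lemma mirrorK : involutive mirror_stack.
Proof. by case=> [[]|]. Qed.

Lemma glue_mirror E D u v : glue D E (mirror_stack u) (mirror_stack v) = glue E D u v.
Proof.
have lu x : mirror_stack (lower_pt x) = upper_pt x by case: x.
have ul x : mirror_stack (upper_pt x) = lower_pt x by case: x.
apply/glueP/glueP => -[] [x].
- by move=> /(canRL mirrorK) -> /(canRL mirrorK) ->; rewrite !lu; right; exists x.
- by move=> /(canRL mirrorK) -> /(canRL mirrorK) ->; rewrite !ul; left; exists x.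
- by move=> -> ->; rewrite !lu; right; exists x.
- by move=> -> ->; rewrite !ul; left; exists x.
Qed.

Lemma connect_mirror E D u v :
  connect (glue D E) (mirror_stack u) (mirror_stack v) = connect (glue E D) u v.
Proof.
suff H E' D' u' v' : connect (glue E' D') u' v' ->
    connect (glue D' E') (mirror_stack u') (mirror_stack v').
  by apply/idP/idP; [rewrite -{2}[u]mirrorK -{2}[v]mirrorK|]; apply: H.
case/connectP=> p; elim: p u' => [|w p IHp] u' /= => [_ ->|/andP[uw pw] vE].
  exact: connect0.
by apply: connect_trans (IHp _ pw vE); rewrite connect1 // glue_mirror.
Qed.

Lemma mirror_outer (x : points t t) :
  mirror_stack (of_outer n x) = of_outer n (flip_point x).
Proof. by case: x. Qed.

(** Reflecting the glued picture exchanges D and E. Through [glue_idP], gluing to the identity is a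
    property of the components, which the reflection preserves, and loops are mapped to loops. *)
Lemma glue_form_sym (R : pzSemiRingType) (delta : R) D E :
  involutive E -> involutive D -> glue_form delta E D = glue_form delta D E.
Proof.
move=> Ei Di; rewrite /glue_form.
have symED := sym_connect_sym (glue_sym Ei Di).
have symDE := sym_connect_sym (glue_sym Di Ei).
have -> : (stack (reflect_pairing E) D == id_pairing t) =
          (stack (reflect_pairing D) E == id_pairing t).
  apply/(glue_idP Ei Di)/(glue_idP Di Ei) => H x y.
    by rewrite -connect_mirror !mirror_outer H; case: x => x; case: y => y.
  by rewrite -connect_mirror !mirror_outer H; case: x => x; case: y => y.
suff -> : nb_loops (reflect_pairing E) D = nb_loops (reflect_pairing D) E by [].
pose loops := [pred v | ~~ [exists x : points t t, connect (glue E D) (of_outer n x) v]].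
have cl : closed (glue E D) loops.
  move=> u v uv; rewrite !inE; congr (~~ _).
  by apply/eq_existsb => x; exact: same_connect1r.
have adj : rel_adjunction mirror_stack (glue E D) (glue D E) loops.
  apply: strict_adjunction => //; first exact: can_inj mirrorK.
    by apply/subsetP => v _; rewrite -[v]mirrorK codom_f.
  by move=> u v _; rewrite -(glue_mirror D E) .
rewrite -[LHS]/(n_comp (glue E D) loops) (adjunction_n_comp mirror_stack symED symDE cl adj).
apply: eq_n_comp_r => v; rewrite !inE; congr (~~ _).
apply/existsP/existsP => -[x xv]; exists (flip_point x);
  by rewrite -connect_mirror mirror_outer ?mirrorK //; case: x xv.
Qed.

End Glue.

Lemma glue_form_id (R : pzSemiRingType) (delta : R) t :
  glue_form delta (id_pairing t) (id_pairing t) = 1.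
Proof.
set I := id_pairing t.
have Ii : involutive I by move=> x; rewrite !ffunE; case: x.
have GL x : glue I I (lower_pt x) (lower_pt (I x)) by apply/glueP; left; exists x.
have GU x : glue I I (upper_pt x) (upper_pt (I x)) by apply/glueP; right; exists x.
have sym := sym_connect_sym (glue_sym Ii Ii).
(* Each component is one vertical line, and [label] tells which. All vertices lie on such lines, so
   there is no loop. *)
pose label (v : stack_points t t t) : 'I_t :=
  match v with inl (inl a) => a | inl (inr a) => a | inr a => a end.
have label_connect u v : connect (glue I I) u v -> label u = label v.
  case/connectP=> p; elim: p u => [|w p IHp] u /=; first by move=> _ ->.
  case/andP=> /glueP uw pw vE; rewrite -(IHp w) //.
  by case: uw => -[x -> ->]; rewrite ffunE; case: x.
have bot a : connect (glue I I) (inl (inl a)) (inl (inr a)).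
  by have := connect1 (GL (inl a)); rewrite ffunE.
have top a : connect (glue I I) (inr a) (inl (inr a)).
  by have := connect1 (GU (inl a)); rewrite ffunE.
rewrite /glue_form; have -> : stack (reflect_pairing I) I == I.
  apply/glue_idP => // x y; apply/idP/idP => [/label_connect|].
    by case: x => a; case: y => b /= ->; rewrite eqxx ?orbT.
  have bt a : connect (glue I I) (inl (inl a)) (inr a).
    by apply: connect_trans (bot a) _; rewrite sym.
  by case/orP=> /eqP->; [exact: connect0 | case: x => a //=; rewrite sym].
have -> : nb_loops (reflect_pairing I) I = 0%N; last by rewrite expr0.
apply: eq_card0 => v; rewrite !inE; apply/negP => /andP[_ /negP]; apply.
apply/existsP; case: v => [[a|a]|a]; [exists (inl a) | exists (inl a) | exists (inr a)].
- exact: connect0.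
- exact: bot.
- exact: connect0.
Qed.

(** * The form on numbered matchings *)

Section Gram.
Variables (R : comNzRingType) (delta : R).
Local Notation g := (gram delta).

Lemma eq_gram n t m1 m2 m1' m2' : eq_below (n + t) m1 m1' -> eq_below (n + t) m2 m2' ->
  g n t m1 m2 = g n t m1' m2'.
Proof. by move=> E1 E2; rewrite /gram (eq_pairing_of E1) (eq_pairing_of E2). Qed.

(** Cups and caps are adjoint: a cup of the left diagram becomes a cap on the right one. The factor
    [delta] is the loop closed when both have the same cup. *)
Lemma gram_cup n t i X m : (i <= n)%N ->
  matching (n + t) X -> matching (n.+2 + t) m ->
  g n.+2 t (add_arc i X) m =
  (if m i == i.+1 then delta else 1) * g n t X (join_arc i m).
Proof.
move=> le_in XM mM.
have [iN i1N] : (i < n.+2 /\ i.+1 < n.+2)%N by lia.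
have iNt : (i <= n + t)%N by lia.
have mM2 : matching (n + t).+2 m by [].
have X1M : matching (n.+2 + t) (add_arc i X) by apply: add_arc_matching.
have JM : matching (n + t) (join_arc i m) by apply: join_arc_matching.
pose ti : 'I_n.+2 := Ordinal iN; pose ti1 : 'I_n.+2 := Ordinal i1N.
pose sk (j : 'I_n) : 'I_n.+2 := inord (skip2 i j).
have skE j : sk j = skip2 i j :> nat by rewrite inordK // skip2_lt.
have pos_lift (x : points t n) : pos (lift_pt sk x) = skip2 i (pos x).
  by case: x => [a|j] /=; [rewrite /skip2 ifN; lia | rewrite skE].
have sk_inj : injective sk.
  by move=> j j' /(congr1 val); rewrite /= !skE => /skip2_inj/ord_inj.
have sk_neq j : (sk j != ti) && (sk j != ti1).
  by rewrite -!(inj_eq (@ord_inj _)) !skE skip2_neq.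
have sk_cover k : k != ti -> k != ti1 -> exists j, k = sk j.
  rewrite -!(inj_eq (@ord_inj _)) /= => k1 k2.
  have lt_k : (unskip2 i k < n)%N by rewrite -(skip2_lt _ le_in) unskip2K.
  by exists (Ordinal lt_k); apply/ord_inj; rewrite skE /= unskip2K.
have ti_neq : (ti1 == ti) = false by apply/negbTE; rewrite -(inj_eq (@ord_inj _)) /=; lia.
pose E1 := pairing_of t n.+2 (add_arc i X); pose D := pairing_of t n.+2 m.
pose E := pairing_of t n X; pose D' := pairing_of t n (join_arc i m).
have E1ti : E1 (inr ti) = inr ti1.
  by apply: pos_inj; rewrite pos_pairing_of //= add_arcE.
have E1ti1 : E1 (inr ti1) = inr ti.
  by apply: pos_inj; rewrite pos_pairing_of //= add_arcE.
have E1sk x : E1 (lift_pt sk x) = lift_pt sk (E x).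
  by apply: pos_inj; rewrite pos_pairing_of // !pos_lift add_arcE pos_pairing_of.
have D'sk x : lift_pt sk (D' x) =
  if D (lift_pt sk x) == inr ti then D (inr ti1)
  else if D (lift_pt sk x) == inr ti1 then D (inr ti) else D (lift_pt sk x).
  apply: pos_inj; rewrite pos_lift pos_pairing_of // (skip2_join iNt mM2) ?pos_lt //.
  rewrite -!(inj_eq (@pos_inj _ _)) pos_pairing_of // pos_lift /=.
  by do 2?case: ifP => _; rewrite pos_pairing_of //= pos_lift.
have Dti : (D (inr ti) == inr ti1) = (m i == i.+1).
  by rewrite -(inj_eq (@pos_inj _ _)) pos_pairing_of.
rewrite /gram /glue_form -/E1 -/D -/E -/D' -Dti.
case: (eqVneq (D (inr ti)) (inr ti1)) => [loop|noloop].
  have [-> ->] := contract_loop sk_inj sk_neq sk_cover (pairing_of_involutive XM)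
    (pairing_of_involutive JM) (pairing_of_involutive X1M)
    (pairing_of_involutive mM) E1ti E1ti1 E1sk D'sk loop.
  by rewrite exprS; case: ifP => _; rewrite ?mulr0.
have [-> ->] := contract_noloop sk_inj sk_neq sk_cover (pairing_of_involutive XM)
    (pairing_of_involutive JM) (pairing_of_involutive X1M)
    (pairing_of_involutive mM) (fun x => pairing_of_neq x mM) ti_neq
    E1ti E1ti1 E1sk D'sk noloop.
by rewrite mul1r.
Qed.

(** An arc of [m] between two bottom points survives gluing, and the identity has no such arc. *)
Lemma gram_through0 n t X m x : matching (n + t) X -> matching (n + t) m ->
  (n <= x < n + t)%N -> (n <= m x)%N -> g n t X m = 0.
Proof.
move=> XM mM /andP[nx xN] nmx; rewrite /gram /glue_form.
set E := pairing_of t n X; set D := pairing_of t n m.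
have bottom k : (k < n + t)%N -> (n <= k)%N ->
    exists a : 'I_t, pos (inl a : points t n) = k.
  move=> kN nk; have [[a|j] eq_k] := pos_surj kN; first by exists a.
  by have := ltn_ord j; rewrite -eq_k /= in nk *; lia.
have [a ax] := bottom _ xN nx.
have [b bx] := bottom _ (matching_lt mM xN) nmx.
have Da : D (inl a) = inl b by apply: pos_inj; rewrite pos_pairing_of // ax bx.
have Dn := @pairing_of_neq t n m _ mM.
case: ifP => // /(glue_idP (pairing_of_involutive XM) (pairing_of_involutive mM)).
move=> /(_ (inl a) (inl b)); rewrite connect1; last first.
  by apply/glueP; left; exists (inl a) => //; rewrite Da.
move=> /esym; rewrite orbF => /eqP[e]; have := Dn (inl a).
by rewrite -/D Da e eqxx.
Qed.

Lemma gram_sym n t X m : matching (n + t) X -> matching (n + t) m ->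
  g n t X m = g n t m X.
Proof.
move=> XM mM; rewrite /gram; apply: glue_form_sym; exact: pairing_of_involutive.
Qed.

Lemma gram_id t m m' :
  (forall x, x < t + t -> m x = (t + t).-1 - x)%N ->
  (forall x, x < t + t -> m' x = (t + t).-1 - x)%N -> g t t m m' = 1.
Proof.
move=> mE m'E; rewrite /gram (eq_pairing_of (m' := m)); last first.
  by move=> x xN; rewrite mE ?m'E.
have mM : matching (t + t) m.
  by split=> [x xN|x xN|x xN|x y xN yN]; rewrite ?mE //; lia.
have -> : pairing_of t t m = id_pairing t.
  apply/ffunP => x; apply: pos_inj; rewrite pos_pairing_of // mE ?pos_lt // ffunE.
  by case: x => [a|a] /=; have := ltn_ord a; lia.
exact: glue_form_id.
Qed.
End Gram.

Lemma eq_below_trans N m1 m2 m3 : eq_below N m1 m2 -> eq_below N m2 m3 -> eq_below N m1 m3.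
Proof. by move=> E1 E2 x xN; rewrite E1 ?E2. Qed.

Lemma eq_below_sym N m1 m2 : eq_below N m1 m2 -> eq_below N m2 m1.
Proof. by move=> E x xN; rewrite E. Qed.

Lemma eq_below_refl N m : eq_below N m m. Proof. by []. Qed.

Lemma add_arc_eq_below N p m m' : (p <= N)%N -> eq_below N m m' ->
  eq_below N.+2 (add_arc p m) (add_arc p m').
Proof.
move=> pN E x; case: (skip2P p x) => [||z]; rewrite !add_arcE // skip2_lt //.
by move=> zN; rewrite E.
Qed.

Lemma join_through n t i D : matching (n.+2 + t) D -> through n.+2 t D ->
  (i <= n)%N -> ~~ ((n.+2 <= D i) && (n.+2 <= D i.+1))%N ->
  through n t (join_arc i D).
Proof.
move=> DM thr le_in nb x /andP[nx xN].
have iNt : (i <= n + t)%N by lia.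
rewrite -(skip2_lt _ le_in) (skip2_join iNt) //; cbv zeta.
have -> : skip2 i x = x.+2 by rewrite /skip2 ifN; lia.
have xN2 : (x.+2 < n.+2 + t)%N by lia.
have := thr x.+2; have := @matching_sym _ _ _ i DM xN2.
have := @matching_sym _ _ _ i.+1 DM xN2.
by do 2?[case: ifP => ?]; lia.
Qed.

(** * The recursion for the Gram matrices *)

Section Qint.
Variables (R : comNzRingType) (delta : R).

(* At the loop value [delta = - (q + q^-1)] this is the quantum integer [[k]]. *)
Fixpoint qint (k : nat) : R :=
  match k with
  | 0 => 0
  | k1.+1 => match k1 with 0 => 1 | k2.+1 => - delta * qint k1 - qint k2 end
  end.

Lemma qintSS k : qint k.+2 = - delta * qint k.+1 - qint k.
Proof. by []. Qed.

(** This is [[k+1]] - [[2]] [[k]] + [[k-1]] = 0 for k = t - k0, with [[2]] = -[delta]. The leading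
    summand supplies [[t+1]] when k0 = 0, and at the other end [[0]] = 0. *)
Lemma qint_cap_sum t k0 : (k0 < t)%N ->
  qint t.+1 * (k0 == 0%N)%:R +
  \sum_(k < t) qint (t - k) *
    ((k == k0 :> nat)%:R * delta + (k == k0.+1 :> nat)%:R + (k.+1 == k0)%:R) = 0.
Proof.
move=> k0t.
have pick j (f : nat -> R) : (j < t)%N -> \sum_(k < t) f k * (k == j :> nat)%:R = f j.
  move=> jt; rewrite (bigD1 (Ordinal jt)) //= eqxx mulr1 big1 ?addr0 // => k kj.
  by rewrite -(inj_eq (@ord_inj _)) /= in kj; rewrite (negPf kj) mulr0.
under eq_bigr => k _ do rewrite !mulrDr mulrA -[_ * _ * delta]mulrAC.
rewrite !big_split /=.
rewrite (pick k0 (fun k => qint (t - k) * delta)) //.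
have -> : \sum_(k < t) qint (t - k) * (k == k0.+1 :> nat)%:R = qint (t - k0.+1).
  have [lt_t|] := ltnP k0.+1 t; first exact: (pick k0.+1 (fun k => qint (t - k))).
  move=> le_t; rewrite (_ : (t - k0.+1 = 0)%N) /=; last by lia.
  by rewrite big1 // => k _; rewrite (_ : (k == k0.+1 :> nat) = false) ?mulr0 //;
     have := ltn_ord k; lia.
have -> : \sum_(k < t) qint (t - k) * (k.+1 == k0)%:R = qint (t - k0).+1 * (k0 != 0%N)%:R.
  case: k0 k0t => [|j] jt; first by rewrite mulr0 big1 // => k _; rewrite mulr0.
  rewrite mulr1 subnSK 1?ltnW //.
  by rewrite -(pick j (fun k => qint (t - k))) 1?ltnW.
rewrite -subSn 1?ltnW //.
have -> : qint t.+1 * (k0 == 0%N)%:R = qint (t.+1 - k0) * (k0 == 0%N)%:R.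
  by case: k0 {k0t} => [|k0]; rewrite ?subn0 ?mulr0.
have -> : (t.+1 - k0 = (t - k0.+1).+2)%N by lia.
have -> : (t - k0 = (t - k0.+1).+1)%N by lia.
by rewrite qintSS; case: eqP => _ /=; ring.
Qed.
End Qint.

Section Phi.
Variables (R : comNzRingType) (delta : R).
Local Notation g := (gram delta).
Local Notation q := (qint delta).

(* The form of [X] with the vector Phi(D) of the introduction. *)
Definition phi_form n t X D : R :=
  q t.+1 * g n.+1 t X D +
  \sum_(k < t) q (t - k) * g n.+1 t X (add_arc n (join_arc (n + k) D)).

Section Cup.
Variables (n t i : nat) (X D : nat -> nat).
Hypotheses (le_in : (i <= n)%N) (XM : matching (n.+1 + t) X).
Hypotheses (DM : matching (n.+2 + t.+1) D) (thr : through n.+2 t.+1 D).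

Let DM' : matching (n.+1 + t).+2 D. Proof. by move: DM; rewrite addnS. Qed.
Let iN : (i <= n.+1 + t)%N. Proof. by lia. Qed.
Let mM := join_arc_matching iN DM'.

(** Capping at i commutes with the two operations that build a summand of Phi(D), since both take
    place further to the right. As bottom points are numbered from the right, summand k is D_i of
    the introduction for the index t - k. *)
Lemma cup_term k : (k < t)%N ->
  g n.+3 t (add_arc i X) (add_arc n.+2 (join_arc (n.+2 + k) D)) =
  (if add_arc n.+2 (join_arc (n.+2 + k) D) i == i.+1 then delta else 1) *
  g n.+1 t X (add_arc n (join_arc (n + k) (join_arc i D))).
Proof.
move=> kt; have kN : (n.+2 + k <= n.+1 + t)%N by lia.
have JM := join_arc_matching kN DM'.
have nN : (n.+2 <= n.+1 + t)%N by lia.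
have AM : matching (n.+3 + t) (add_arc n.+2 (join_arc (n.+2 + k) D)).
  exact: add_arc_matching.
have iSn : (i <= n.+1)%N by lia.
rewrite (gram_cup delta iSn XM AM).
apply: (congr1 ( *%R _)); apply: eq_gram => //.
have [N' N'E] : exists N', (n.+1 + t = N'.+2)%N.
  by exists (n + t).-1; lia.
have DM2 := DM'; rewrite N'E in JM nN kN DM2 *.
apply: eq_below_trans (@join_add_comm N' i n.+2 _ _ _ JM) _; [lia | lia |].
apply: add_arc_eq_below; first by lia.
by apply: (@join_join_comm N' i (n.+2 + k) D) => //; lia.
Qed.

(** A loop closes if D has the cup, or if i and i+1 go to the two bottom points just joined.
    Noncrossing leaves only one order for these partners. *)
Lemma loop_term k : (k < t)%N ->
  (add_arc n.+2 (join_arc (n.+2 + k) D) i == i.+1) =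
  (D i == i.+1) || ((D i == (n.+2 + k).+1) && (D i.+1 == (n.+2 + k))).
Proof.
move=> kt; have kN : (n.+2 + k <= n.+1 + t)%N by lia.
have i2 : skip2 n.+2 i = i by rewrite skip2_small //; lia.
rewrite -{1}i2 add_arcE skip2_eq; last by lia.
rewrite -(@skip2_eq (n.+2 + k) _ i.+1); last by lia.
have iN1 : (i < n.+1 + t)%N by lia.
rewrite (skip2_join kN DM') //; cbv zeta.
rewrite (@skip2_small (n.+2 + k)); last by lia.
have [iN2 i1N2] : (i < (n.+1 + t).+2 /\ i.+1 < (n.+1 + t).+2)%N by lia.
have := @matching_sym _ _ _ (n.+2 + k) DM' i1N2.
have := @matching_sym _ _ _ (n.+2 + k).+1 DM' i1N2.
have [pN p1N] : (n.+2 + k < (n.+1 + t).+2 /\ (n.+2 + k).+1 < (n.+1 + t).+2)%N by lia.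
have := @matching_sym _ _ _ i.+1 DM' pN; have := @matching_sym _ _ _ i.+1 DM' p1N.
have := @matching_sym _ _ _ i DM' pN; have := @matching_sym _ _ _ i DM' p1N.
have := @matching_sym _ _ _ (n.+2 + k) DM' iN2.
have := @matching_sym _ _ _ (n.+2 + k).+1 DM' iN2.
have := matching_nest DM' iN2 i1N2.
move: (D i) (D i.+1) (D (n.+2 + k)) (D (n.+2 + k).+1) => a b c d *.
by case: (eqVneq a (n.+2 + k)%N) => ?; [|case: (eqVneq a (n.+2 + k).+1) => ?]; lia.
Qed.

(** When i and i+1 are not both on through strands, only the first case of [loop_term] occurs, so
    the loop factor is the same for all summands. *)
Lemma phi_cup : ~~ ((n.+2 <= D i) && (n.+2 <= D i.+1))%N ->
  phi_form n.+2 t (add_arc i X) D =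
  (if D i == i.+1 then delta else 1) * phi_form n t X (join_arc i D).
Proof.
move=> nb; rewrite /phi_form mulrDr; congr (_ + _).
  have iSn : (i <= n.+1)%N by lia.
  rewrite (gram_cup delta iSn XM DM'); rewrite !mulrA; congr (_ * _); exact: mulrC.
rewrite big_distrr; apply: eq_bigr => k _ /=.
rewrite cup_term ?ltn_ord // loop_term ?ltn_ord //.
have -> : (D i == (n.+2 + k).+1) && (D i.+1 == (n.+2 + k)%N) = false.
  by apply: contraNF nb => /andP[/eqP-> /eqP->]; lia.
by rewrite orbF !mulrA; congr (_ * _); exact: mulrC.
Qed.

(* Here capping [D] joins two adjacent bottom points, k0 and k0+1 say, and only the
   terms k0-1, k0, k0+1 of Phi(D) survive. *)
Lemma phi_cup_eq0 : (n.+2 <= D i)%N -> (n.+2 <= D i.+1)%N ->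
  phi_form n.+2 t (add_arc i X) D = 0.
Proof.
move=> Di Di1.
have lt_i : (i.+1 < n.+2)%N by lia.
have nested := nested_partners DM thr lt_i Di Di1.
have [k0 k0E] : exists k0, (D i.+1 = n.+2 + k0)%N by exists (D i.+1 - n.+2)%N; lia.
rewrite k0E in nested.
have [iN2 i1N2] : (i < (n.+1 + t).+2 /\ i.+1 < (n.+1 + t).+2)%N by lia.
have k0t : (k0 < t)%N by have := matching_lt DM' iN2; lia.
have Dp := matching_sym DM' i1N2 k0E; have Dp1 := matching_sym DM' iN2 nested.
set m := join_arc i D.
have mk0 : m (n + k0)%N = (n + k0).+1.
  apply: (@skip2_inj i); rewrite (skip2_join iN DM') /=; last by lia.
  have -> : skip2 i (n + k0)%N = (n.+2 + k0)%N by rewrite /skip2 ifN; lia.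
  rewrite Dp nested eqxx; case: eqP => [|_]; first by lia.
  by rewrite /skip2 ifN; lia.
pose G := g n.+1 t X (add_arc n (join_arc (n + k0)%N m)).
(* With n+1 top points, the point n is a top point. Hence the arc of [m] at n+k0 is a vertical
   strand if k0 = 0, and otherwise joins two bottom points. *)
have G0 : g n.+1 t X m = (k0 == 0%N)%:R * G.
  have [k00|k0n0] := eqVneq k0 0%N; last first.
    rewrite mul0r; apply: (gram_through0 delta (x := (n + k0)%N) XM mM); rewrite -/m ?mk0; lia.
  rewrite mulr1n mul1r /G; rewrite k00 addn0 in mk0 *; apply: eq_gram => //; apply: eq_below_sym.
  have nN : (n <= (n + t).-1)%N by lia.
  have NE : (n.+1 + t = (n + t).-1.+2)%N by lia.
  by rewrite NE; apply: add_join_arc => //; rewrite -NE.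
have Gk k : (k < t)%N -> g n.+1 t X (add_arc n (join_arc (n + k)%N m)) =
    ((k == k0) || (k == k0.+1) || (k.+1 == k0))%:R * G.
  move=> kt.
  have NE : (n.+1 + t = (n + t).-1.+2)%N by lia.
  have mM2 : matching (n + t).-1.+2 m by rewrite -NE.
  have nN : (n <= (n + t).-1)%N by lia.
  have [->|kk0] := eqVneq k k0; first by rewrite /= mulr1n mul1r.
  have [e|kk01] := eqVneq k k0.+1.
    subst k; rewrite ?orbT /= mulr1n mul1r /G addnS; apply: eq_gram => //; rewrite NE.
    by apply: add_arc_eq_below => //; apply: join_arc_succ => //; lia.
  have [kk02|kk02] := eqVneq k.+1 k0.
    rewrite /= mulr1n mul1r /G -kk02 addnS; apply: eq_gram => //; rewrite NE.
    apply: add_arc_eq_below => //; rewrite -kk02 addnS in mk0.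
    by apply: (@join_arc_pred _ (n + k).+1) => //; lia.
  rewrite mul0r.
  have kN : (n + k <= (n + t).-1)%N by lia.
  have JM := join_arc_matching kN mM2.
  have AM : matching (n.+1 + t) (add_arc n (join_arc (n + k)%N m)).
    by rewrite NE; apply: add_arc_matching.
  (* For k away from k0, the arc from n+k0 to n+k0+1 survives the operations as an arc between two
     bottom points. *)
  have above k1 : ((k1 == k0) || (k1 == k0.+1)) ->
      (n.+1 < skip2 n (unskip2 (n + k)%N (n + k1)%N) < n.+1 + t)%N.
    move=> k1E; set y := unskip2 _ _.
    have : (n <= y)%N && (y.+1 < n + t)%N by rewrite /y /unskip2; case: ifP => ?; lia.
    by rewrite /skip2; case: ifP => ?; lia.
  have /andP[abv1 abv2] := above k0 (introT orP (or_introl (eqxx _))).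
  have /andP[abv3 _] := above k0.+1 (introT orP (or_intror (eqxx _))).
  apply: (gram_through0 delta (x := skip2 n (unskip2 (n + k)%N (n + k0)%N)) XM AM).
    by rewrite (ltnW abv1).
  rewrite add_arcE /join_arc unskip2K; try lia.
  rewrite mk0 /= ifN; last by lia.
  by rewrite ifN -?addnS; [exact: ltnW | lia].
rewrite /phi_form.
have iSn : (i <= n.+1)%N by lia.
rewrite (gram_cup delta iSn XM DM') -/m nested.
have -> : ((n.+2 + k0).+1 == i.+1) = false by lia.
rewrite mul1r G0.
have -> : \sum_(k < t) q (t - k) *
    g n.+3 t (add_arc i X) (add_arc n.+2 (join_arc (n.+2 + k) D)) =
  \sum_(k < t) q (t - k) *
    ((k == k0 :> nat)%:R * delta + (k == k0.+1 :> nat)%:R + (k.+1 == k0)%:R) * G.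
  apply: eq_bigr => k _; rewrite cup_term ?ltn_ord // loop_term ?ltn_ord // -mulrA.
  apply: (congr1 ( *%R _)); rewrite -/m Gk ?ltn_ord // nested k0E.
  have -> : ((n.+2 + k0).+1 == i.+1) = false by lia.
  have -> : ((n.+2 + k0).+1 == (n.+2 + k).+1) && ((n.+2 + k0)%N == (n.+2 + k)%N)
     = (k == k0 :> nat) by lia.
  have [->|kk0] := eqVneq (k : nat) k0.
    have -> : (k0 == k0.+1) = false by lia.
    have -> : (k0.+1 == k0) = false by lia.
    by rewrite /= !mulr1n !mulr0n !mul1r !addr0.
  have [->|kk01] := eqVneq (k : nat) k0.+1.
    have -> : (k0.+2 == k0) = false by lia.
    by rewrite /= !mulr1n !mulr0n !mul1r mul0r add0r addr0 mul1r.
  by rewrite /= mul1r mulr0n mul0r !add0r.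
by rewrite mulrA -mulr_suml -mulrDl qint_cap_sum // mul0r.
Qed.

End Cup.
End Phi.

Lemma cup_normal n t i E : (i <= n)%N -> matching (n.+2 + t) E -> E i = i.+1 ->
  eq_below (n.+2 + t) E (add_arc i (join_arc i E)).
Proof.
move=> le_in EM Ei; apply: eq_below_sym; rewrite !addSn in EM *.
by apply: add_join_arc => //; lia.
Qed.

Lemma cup_normal_add n t i E : (i <= n)%N -> matching (n.+2 + t) E -> E i = i.+1 ->
  eq_below (n.+3 + t.+1) (add_arc n.+2 E) (add_arc i (add_arc n (join_arc i E))).
Proof.
move=> le_in EM0 Ei; have EM : matching (n + t).+2 E := EM0.
have -> : (n.+3 + t.+1 = (n + t).+4)%N by lia.
have nN : (n.+2 <= (n + t).+2)%N by lia.
have AM := add_arc_matching nN EM.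
have i2 : skip2 n.+2 i = i by rewrite skip2_small //; lia.
have Ai : add_arc n.+2 E i = i.+1.
  by rewrite -{1}i2 add_arcE Ei skip2_small //; lia.
have iN : (i <= (n + t).+2)%N by lia.
apply: eq_below_trans (eq_below_sym (add_join_arc iN AM Ai)) _.
apply: add_arc_eq_below => //.
by apply: join_add_comm => //; lia.
Qed.

Lemma joined_bottoms n t i D : matching (n.+2 + t) D -> through n.+2 t D ->
  (i <= n)%N -> (n.+2 <= D i)%N -> (n.+2 <= D i.+1)%N ->
  exists2 r, (n <= r)%N && (r.+1 < n + t)%N & join_arc i D r = r.+1.
Proof.
move=> DM thr le_in Di Di1.
have lt_i : (i.+1 < n.+2)%N by lia.
have nested := nested_partners DM thr lt_i Di Di1.
have [iN2 i1N2] : (i < n.+2 + t /\ i.+1 < n.+2 + t)%N by lia.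
have Dlt := matching_lt DM iN2; have Ki1 := matchingK DM i1N2.
have iN : (i <= n + t)%N by lia.
exists (D i.+1).-2; first lia.
apply: (@skip2_inj i); rewrite (skip2_join iN DM) /=; last by lia.
have -> : skip2 i (D i.+1).-2 = D i.+1 by rewrite /skip2 ifN; lia.
rewrite Ki1 nested eqxx; case: eqP => [|_]; first by lia.
by rewrite /skip2 ifN; lia.
Qed.

Section Bend.
Variables (R : comNzRingType) (delta : R).
Local Notation g := (gram delta).
Local Notation q := (qint delta).

(** An innermost cup of E is moved across the form. Either E' capped is still monic and induction
    applies, or it joins two bottom points and both sides vanish. Without a cup, E is the identity
    with n = t, and so is E'. *)
Lemma gram_add n t E E' : matching (n + t) E -> through n t E ->
  matching (n + t) E' -> through n t E' ->
  g n.+1 t.+1 (add_arc n E) (add_arc n E') = g n t E E'.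
Proof.
elim/ltn_ind: n => n IHn in E E' *; move=> EM Ethr EM' Ethr'.
have [le_tn [[i lt_in Ei]|[nt Eid]]] := innermost_cup EM Ethr; last first.
  subst n; have [_ [[i lt_in Ei]|[_ Eid']]] := innermost_cup EM' Ethr'.
    clear IHn; case: t => [|[|t]] // in lt_in EM EM' Ethr Ethr' Eid le_tn *.
    have nb : ~~ ((t.+2 <= E' i) && (t.+2 <= E' i.+1))%N by rewrite Ei; lia.
    have thr := join_through EM' Ethr' lt_in nb.
    have JM : matching (t + t.+2) (join_arc i E').
      have iN : (i <= t + t.+2)%N by lia.
      exact: join_arc_matching iN EM'.
    by have [] := innermost_cup JM thr; lia.
  rewrite !gram_id // => x xN.
    case: (skip2P t x) xN => [||z]; rewrite ?add_arcE; try lia.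
    rewrite addSn addnS skip2_lt; last by lia.
    by move=> zN; rewrite Eid // /skip2; do 2?[case: ifP => ?]; lia.
  case: (skip2P t x) xN => [||z]; rewrite ?add_arcE; try lia.
  rewrite addSn addnS skip2_lt; last by lia.
  by move=> zN; rewrite Eid' // /skip2; do 2?[case: ifP => ?]; lia.
case: n => [|[|n]] // in IHn EM Ethr EM' Ethr' le_tn lt_in *.
have le_in : (i <= n)%N by lia.
have iN : (i <= n + t)%N by lia.
have EM2 : matching (n + t).+2 E by []; have EM2' : matching (n + t).+2 E' by [].
have JM := join_arc_matching iN EM2; have JM' := join_arc_matching iN EM2'.
have JAM : matching (n.+1 + t.+1) (add_arc n (join_arc i E)).
  by rewrite addSn addnS; apply: add_arc_matching => //; lia.
have AM' : matching (n.+3 + t.+1) (add_arc n.+2 E').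
  by rewrite addSn addnS; apply: add_arc_matching => //; lia.
rewrite (eq_gram delta (cup_normal_add le_in EM Ei) (@eq_below_refl _ _)).
have iSn : (i <= n.+1)%N by lia.
rewrite (gram_cup delta iSn JAM AM').
rewrite (eq_gram delta (cup_normal le_in EM Ei) (@eq_below_refl _ E')).
rewrite (gram_cup delta le_in JM EM').
have i2 : skip2 n.+2 i = i by rewrite skip2_small //; lia.
have -> : (add_arc n.+2 E' i == i.+1) = (E' i == i.+1).
  by rewrite -{1}i2 add_arcE skip2_eq //; lia.
apply: (congr1 ( *%R _)).
have -> : g n.+1 t.+1 (add_arc n (join_arc i E)) (join_arc i (add_arc n.+2 E')) =
          g n.+1 t.+1 (add_arc n (join_arc i E)) (add_arc n (join_arc i E')).
  apply: eq_gram => //; rewrite addSn addnS.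
  by apply: join_add_comm => //; lia.
have nbE : ~~ ((n.+2 <= E i) && (n.+2 <= E i.+1))%N by rewrite Ei; lia.
have [/andP[b1 b2]|nb] := boolP ((n.+2 <= E' i) && (n.+2 <= E' i.+1))%N.
  have [r /andP[nr rN] Jr] := joined_bottoms EM' Ethr' le_in b1 b2.
  rewrite (gram_through0 delta (x := r) JM JM') ?Jr; try lia.
  have JAM' : matching (n.+1 + t.+1) (add_arc n (join_arc i E')).
    by rewrite addSn addnS; apply: add_arc_matching => //; lia.
  rewrite (gram_through0 delta (x := skip2 n r) JAM JAM') ?add_arcE ?Jr //;
    by rewrite /skip2; do 2?[case: ifP => ?]; lia.
apply: IHn => //.
  exact: join_through.
exact: join_through.
Qed.

Lemma eq_phi_form n t X X' D : eq_below (n.+1 + t) X X' ->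
  phi_form delta n t X D = phi_form delta n t X' D.
Proof.
move=> E; rewrite /phi_form (eq_gram delta E (@eq_below_refl _ D)); apply: (congr1 ( +%R _)).
by apply: eq_bigr => k _; rewrite (eq_gram delta E (@eq_below_refl _ _)).
Qed.

(** The orthogonality of Phi(D) to vertical strands. The existence of D gives t+2 <= n, so E has an
    innermost cup; moving it across reduces n, and the induction needs no base case. *)
Lemma phi_form_add n t E D : matching (n + t) E -> through n t E ->
  matching (n + t.+2) D -> through n t.+2 D ->
  phi_form delta n t.+1 (add_arc n E) D = 0.
Proof.
elim/ltn_ind: n => n IHn in E D *; move=> EM Ethr DM Dthr.
have [le_tn _] := innermost_cup DM Dthr.
have [_ [[i lt_in Ei]|[nt _]]] := innermost_cup EM Ethr; last by lia.
case: n => [|[|n]] // in IHn EM Ethr DM Dthr le_tn lt_in *.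
have le_in : (i <= n)%N by lia.
have iN : (i <= n + t)%N by lia.
have EM2 : matching (n + t).+2 E by [].
have JM := join_arc_matching iN EM2.
have JAM : matching (n.+1 + t.+1) (add_arc n (join_arc i E)).
  by rewrite addSn addnS; apply: add_arc_matching => //; lia.
rewrite (eq_phi_form _ (cup_normal_add le_in EM Ei)).
have [/andP[b1 b2]|nb] := boolP ((n.+2 <= D i) && (n.+2 <= D i.+1))%N.
  exact: phi_cup_eq0.
rewrite phi_cup // IHn ?mulr0 //.
- by apply: join_through; rewrite // Ei; lia.
- by apply: join_arc_matching => //; lia.
- exact: join_through.
Qed.

(** The same induction, with a base case n = t+1 where X and D are the identity. *)
Lemma phi_form_bend n t X D : matching (n + t.+1) X -> through n t.+1 X ->
  matching (n + t.+1) D -> through n t.+1 D ->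
  phi_form delta n t X D = - q t.+2 * g n t.+1 X D.
Proof.
elim/ltn_ind: n => n IHn in X D *; move=> XM Xthr DM Dthr.
have [le_tn [[i lt_in Xi]|[nt Xid]]] := innermost_cup XM Xthr.
  case: n => [|[|n]] // in IHn XM Xthr DM Dthr le_tn lt_in *.
  have le_in : (i <= n)%N by lia.
  have iN : (i <= n + t.+1)%N by lia.
  have XM2 : matching (n + t.+1).+2 X by []; have DM2 : matching (n + t.+1).+2 D by [].
  have JM := join_arc_matching iN XM2; have JMD := join_arc_matching iN DM2.
  have XE := cup_normal le_in XM Xi.
  rewrite (eq_gram delta XE (@eq_below_refl _ D)) (gram_cup delta le_in JM DM).
  have XE' : eq_below (n.+3 + t) X (add_arc i (join_arc i X)) by rewrite addSnnS.
  have JM' : matching (n.+1 + t) (join_arc i X) by rewrite addSnnS.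
  rewrite (eq_phi_form _ XE').
  have [/andP[b1 b2]|nb] := boolP ((n.+2 <= D i) && (n.+2 <= D i.+1))%N.
    have [r /andP[nr rN] Jr] := joined_bottoms DM Dthr le_in b1 b2.
    rewrite (gram_through0 delta (x := r) JM JMD) ?Jr ?mulr0; try lia.
    exact: phi_cup_eq0.
  rewrite phi_cup // IHn //; first by rewrite mulrCA.

  - by apply: join_through; rewrite // Xi; lia.
  - exact: join_through.
subst n; have [_ [[i lt_in Di]|[_ Did]]] := innermost_cup DM Dthr.
  case: t => [|t] // in IHn lt_in XM Xthr DM Dthr Xid le_tn *.
  have nb : ~~ ((t.+2 <= D i) && (t.+2 <= D i.+1))%N by rewrite Di; lia.
  have thr := join_through DM Dthr lt_in nb.
  have JM : matching (t + t.+2) (join_arc i D).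
    have iN : (i <= t + t.+2)%N by lia.
    exact: join_arc_matching iN DM.
  by have [] := innermost_cup JM thr; lia.
rewrite (gram_id delta Xid Did) mulr1 {IHn le_tn}.
have Xt : X t = t.+1 by rewrite Xid; lia.
have Dt : D t = t.+1 by rewrite Did; lia.
have tN : (t <= t + t)%N by lia.
have NE : (t.+1 + t.+1 = (t + t).+2)%N by lia.
rewrite NE in XM DM Xid Did.
have XE := eq_below_sym (add_join_arc tN XM Xt).
have JM := join_arc_matching tN XM.
have revJ m : (forall x, x < (t + t).+2 -> m x = (t + t).+2.-1 - x)%N ->
    matching (t + t).+2 m -> forall x, (x < t + t)%N -> join_arc t m x = ((t + t).-1 - x)%N.
  move=> mE mM x xN; apply: (@skip2_inj t); rewrite (skip2_join tN mM) //.
  cbv zeta; rewrite mE ?skip2_lt // /skip2.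
  by case: (ltnP x t) => ?; do 3?[case: ifP => ?]; lia.
rewrite (@eq_phi_form t.+1 t _ _ D XE) /phi_form.
rewrite (gram_cup delta (leqnn t) JM DM) Dt eqxx (gram_id delta (revJ _ Xid XM) (revJ _ Did DM)).
(* The leading term is [delta] [[t+1]]. The summand k = 0 straightens to the identity and gives
   [[t]], and the others join two bottom points. The total is -[[t+2]]. *)
have term k : (k < t)%N ->
    g t.+2 t (add_arc t (join_arc t X)) (add_arc t.+1 (join_arc (t.+1 + k) D)) =
    (k == 0%N)%:R.
  move=> kt; have kN : (t.+1 + k <= t + t)%N by lia.
  have DJM := join_arc_matching kN DM.
  have lt_tt : (t < t + t)%N by lia.
  have AM : matching (t.+2 + t) (add_arc t.+1 (join_arc (t.+1 + k) D)).
    exact: add_arc_matching lt_tt DJM.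
  rewrite (gram_cup delta (leqnn t) JM AM).
  have t2 : skip2 t.+1 t = t by rewrite skip2_small.
  have -> : (add_arc t.+1 (join_arc (t.+1 + k) D) t == t.+1) = false.
    have := add_arc_skip t.+1 (join_arc (t.+1 + k) D) t; rewrite t2 => ->.
    by have /andP[/negPf->] := skip2_neq t.+1 (join_arc (t.+1 + k) D t).
  rewrite mul1r (eq_gram delta (@eq_below_refl _ _) (join_add_zigzag lt_tt DJM)).
  case: k => [|k] in kt kN DJM AM *.
    rewrite addn0; apply: gram_id => // x xN; first by rewrite revJ.
    rewrite addn0 in kN; apply: (@skip2_inj t.+1).
    rewrite (skip2_join kN DM) //; cbv zeta.
    rewrite !Did ?skip2_lt //; try lia.
    rewrite /skip2; case: (ltnP x t.+1) => ?; do 3?[case: ifP => ?]; lia.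
  apply: (gram_through0 delta (x := t) JM DJM); first by lia.
  rewrite /join_arc (@skip2_small _ t) ?Dt; last by lia.
  cbv zeta; rewrite ifN ?ifN /unskip2; try lia.
  by rewrite ifT; lia.
under eq_bigr => k _ do rewrite term ?ltn_ord //.
have -> : \sum_(k < t) q (t - k) * (k == 0%N :> nat)%:R = q t.
  case: t {NE XM DM Xid Did XE JM revJ term Xthr Dthr Xt Dt tN} => [|t]; first by rewrite big_ord0.
  rewrite big_ord_recl subn0 mulr1 big1 ?addr0 // => k _.
  by rewrite mulr0.
by rewrite qintSS mulr1; ring.
Qed.
End Bend.

Lemma join_bottoms_through n t p D : matching (n + t).+2 D -> through n t.+2 D ->
  (p <= t)%N -> through n t (join_arc (n + p) D).
Proof.
move=> DM thr le_pt x /andP[nx xN].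
have pN : (n + p <= n + t)%N by lia.
have xp : (skip2 (n + p) x < (n + t).+2)%N by rewrite skip2_lt.
have nx2 : (n <= skip2 (n + p) x)%N by rewrite /skip2; case: ifP; lia.
have Dx : (D (skip2 (n + p) x) < n)%N by apply: thr; lia.
rewrite /join_arc; cbv zeta; rewrite ifN; last by lia.
by rewrite ifN ?/unskip2; [rewrite ifT; lia | lia].
Qed.

(** * Gram matrices, their determinants and ranks *)

Section GramMatrix.
Variables (R : comNzRingType) (delta : R).
Local Notation g := (gram delta).
Local Notation q := (qint delta).

Definition gram_mx n s : 'M[R]_(ballot n s) :=
  \matrix_(i, j) g n s.-1 (walk_matching i) (walk_matching j).

Definition same_walk n t (k : 'I_(ballot n t.+1)) (m : nat -> nat) : bool :=
  [forall x : 'I_(n + t), walk_matching k x == m x].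

Lemma same_walkP n t (k : 'I_(ballot n t.+1)) m :
  reflect (eq_below (n + t) (walk_matching k) m) (same_walk k m).
Proof.
apply: (iffP forallP) => [H x xN|H x]; first exact: eqP (H (Ordinal xN)).
by apply/eqP/H.
Qed.

Lemma sum_same_walk n t (f : 'I_(ballot n t.+1) -> R) m F :
  matching (n + t) m -> through n t m ->
  (forall k, eq_below (n + t) (walk_matching k) m -> f k = F) ->
  \sum_k f k * (same_walk k m)%:R = F.
Proof.
move=> mM thr fF; have [k0 k0m] := walk_matching_surj mM thr.
rewrite (bigD1 k0) //= (introT (same_walkP _ _) k0m) mulr1 fF //.
rewrite big1 ?addr0 // => k kk0; case: same_walkP => [km|_]; last by rewrite mulr0.
have kk : k = k0 by apply: walk_matching_inj => x xN; rewrite km ?k0m.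
by rewrite kk eqxx in kk0.
Qed.

(** Column j holds the coordinates of the correction terms of Phi(D), for the j-th D, in the basis
    of diagrams with a last vertical strand. There are none for s = 0. *)
Definition bend_coef n s : 'M[R]_(ballot n s, ballot n s.+2) :=
  match s with
  | 0 => 0
  | t.+1 => \matrix_(k, j) \sum_(p < t.+1)
      q (t.+1 - p) * (same_walk k (join_arc (n + p) (walk_matching j)))%:R
  end.

Lemma phi_formE n s X (j : 'I_(ballot n s.+2)) :
  phi_form delta n s X (walk_matching j) =
  q s.+1 * g n.+1 s X (walk_matching j) +
  \sum_k g n.+1 s X (add_arc n (walk_matching k)) * bend_coef n s k j.
Proof.
rewrite /phi_form; apply: (congr1 ( +%R _)).
case: s j => [|t] j.
  by rewrite big_ord0 big1 // => k; case: (ballot0_void k).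
have [jM jthr] := walk_matchingP j.
have jM2 : matching (n + t).+2 (walk_matching j) by move: jM; rewrite !addnS.
under [RHS]eq_bigr => k _ do rewrite mxE big_distrr /=.
rewrite exchange_big /=; apply: eq_bigr => p _.
have le_pt : (p <= t)%N by rewrite -ltnS.
have pN : (n + p <= n + t)%N by rewrite leq_add2l.
have JM := join_arc_matching pN jM2.
have Jthr := join_bottoms_through jM2 jthr le_pt.
under eq_bigr => k _ do rewrite mulrCA.
rewrite -big_distrr /=; apply: (congr1 ( *%R _)); apply/esym.
apply: (@sum_same_walk n t (fun k => g n.+1 t.+1 X (add_arc n (walk_matching k)))
  _ _ JM Jthr) => k km; apply: eq_gram => //.
rewrite addSn addnS; apply: add_arc_eq_below => //; first by rewrite leq_addr.
Qed.

Definition bend_mx n s : 'M[R]_(ballot n s + ballot n s.+2) :=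
  block_mx 1%:M (bend_coef n s) 0 (q s.+1)%:M.

Definition gram_split n s : 'M[R]_(ballot n s + ballot n s.+2) := gram_mx n.+1 s.+1.

(* The columns of [bend_mx] are the vertical strands and the vectors Phi(D). *)
Lemma gram_mul_bend n s :
  gram_split n s *m bend_mx n s =
  block_mx (gram_mx n s) 0 (dlsubmx (gram_split n s)) (- q s.+2 *: gram_mx n s.+2).
Proof.
rewrite -[gram_split n s]submxK mulmx_block !mulmx1 !mulmx0 !addr0 block_mxKdl.
rewrite !mul_mx_scalar; congr block_mx.
- apply/matrixP => i j; rewrite !mxE !walk_matching_lshift [_.+1.-1]/=.
  case: s i j => [|t] i j; first by case: (ballot0_void i).
  have [iM ithr] := walk_matchingP i; have [jM jthr] := walk_matchingP j.
  exact: gram_add.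
- apply/matrixP => i j; rewrite !mxE.
  under eq_bigr => k _ do rewrite !mxE !walk_matching_lshift.
  rewrite walk_matching_lshift walk_matching_rshift addrC -phi_formE.
  case: s i j => [|t] i j; first by case: (ballot0_void i).
  have [iM ithr] := walk_matchingP i; have [jM jthr] := walk_matchingP j.
  exact: phi_form_add.
apply/matrixP => i j; rewrite !mxE.
under eq_bigr => k _ do rewrite !mxE walk_matching_lshift walk_matching_rshift.
rewrite !walk_matching_rshift addrC -phi_formE.
have [iM ithr] := walk_matchingP i; have [jM jthr] := walk_matchingP j.
exact: phi_form_bend.
Qed.

Lemma gram_mx_sym n s : (gram_mx n s)^T = gram_mx n s.
Proof.
apply/matrixP => i j; rewrite !mxE.
case: s i j => [|t] i j; first by case: (ballot0_void i).
have [iM _] := walk_matchingP i; have [jM _] := walk_matchingP j.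
exact: gram_sym.
Qed.

(** Both sides of [gram_mul_bend] are products of block triangular matrices up to the Gram matrix
    itself. No division occurs, so this applies over K[X]. *)
Lemma det_gram_rec n s :
  \det (gram_mx n.+1 s.+1) * q s.+1 ^+ ballot n s.+2 =
  \det (gram_mx n s) * ((- q s.+2) ^+ ballot n s.+2 * \det (gram_mx n s.+2)).
Proof.
rewrite -detZ -(det_lblock _ (dlsubmx (gram_split n s))) -gram_mul_bend det_mulmx.
by rewrite det_ublock det1 mul1r det_scalar.
Qed.

Lemma det_gram_base s : \det (gram_mx 0 s) = 1.
Proof.
case: s => [|[|s]]; [exact: det_mx00 | | exact: det_mx00].
have -> : gram_mx 0 1 = (1%:M : 'M_1); last by rewrite det1.
apply/matrixP => i j; rewrite !mxE !ord1 eqxx.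
by apply: gram_id => x; rewrite ltn0.
Qed.

Lemma det_gram_void n : \det (gram_mx n 0) = 1.
Proof. by case: n => [|n]; exact: det_mx00. Qed.

End GramMatrix.

(** P is invertible as [[s+1]] is nonzero. The congruent matrix P^T G P is block lower triangular by
    [gram_mul_bend] and symmetric, hence block diagonal. *)
Lemma rank_gram_rec (K : fieldType) (delta : K) n s : qint delta s.+1 != 0 ->
  \rank (gram_mx delta n.+1 s.+1) =
  (\rank (gram_mx delta n s) +
   (qint delta s.+2 != 0%R) * \rank (gram_mx delta n s.+2))%N.
Proof.
move=> q0; set G := gram_split delta n s; set P := bend_mx delta n s.
have Punit : P \in unitmx.
  by rewrite unitmxE det_ublock det1 mul1r det_scalar unitfE expf_neq0.
have GP := gram_mul_bend delta n s; rewrite -/G -/P in GP.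
have PT : P^T = block_mx 1%:M 0 (bend_coef delta n s)^T (qint delta s.+1)%:M.
  by rewrite tr_block_mx !trmx1 trmx0 tr_scalar_mx.
have Gsym : G^T = G by exact: (gram_mx_sym delta n.+1 s.+1).
have PGP : P^T *m (G *m P) = block_mx (gram_mx delta n s) 0 0
    (qint delta s.+1 *: (- qint delta s.+2 *: gram_mx delta n s.+2)).
  have : (P^T *m (G *m P))^T = P^T *m (G *m P).
    by rewrite !trmx_mul trmxK Gsym mulmxA.
  rewrite GP PT mulmx_block !mul1mx !mul0mx !mulmx0 !addr0 add0r.
  rewrite !mul_scalar_mx tr_block_mx => /eq_block_mx[_ _ <- _].
  by rewrite trmx0.
rewrite -[LHS]/(\rank G).
have <- : \rank (P^T *m (G *m P)) = \rank G.
  rewrite mulmxA mxrankMfree ?row_free_unit // -mxrank_tr trmx_mul trmxK.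
  by rewrite mxrankMfree ?row_free_unit // mxrank_tr.
rewrite PGP rank_diag_block_mx mxrank_scale_nz //; congr (_ + _)%N.
have [->|q1] := eqVneq (qint delta s.+2) 0.
  by rewrite oppr0 scale0r mxrank0.
by rewrite mxrank_scale_nz ?oppr_eq0 // mul1n.
Qed.

Lemma ballot_gt n s : (n.+1 < s)%N -> ballot n s = 0%N.
Proof.
elim: n s => [|n IHn] [|s] //=; first by case: s.
by move=> ns; rewrite !IHn; lia.
Qed.

Lemma gram_mx_map (R S : comNzRingType) (f : {rmorphism R -> S}) (delta : R) n s :
  map_mx f (gram_mx delta n s) = gram_mx (f delta) n s.
Proof.
apply/matrixP => i j; rewrite !mxE /gram /glue_form.
by case: ifP => _; rewrite ?rmorphXn ?rmorph0.
Qed.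

Lemma qint_map (R S : comNzRingType) (f : {rmorphism R -> S}) (delta : R) k :
  f (qint delta k) = qint (f delta) k.
Proof.
elim/ltn_ind: k => -[|[|k]] IHk; [exact: rmorph0 | exact: rmorph1 |].
by rewrite !qintSS rmorphB rmorphM rmorphN !IHk.
Qed.

Lemma qint_addition (R : comNzRingType) (delta : R) a b :
  qint delta (a + b).+1 = qint delta a.+1 * qint delta b.+1 - qint delta a * qint delta b.
Proof.
elim/ltn_ind: b => -[|[|b]] IHb.
- by rewrite addn0 /= mulr1 mulr0 subr0.
- by rewrite addn1 qintSS /=; ring.
have e1 := IHb b.+1 (ltnSn _); have e2 := IHb b (leqnSn _).
rewrite addnS in e1; rewrite !addnS qintSS e1 e2.
by rewrite (qintSS _ b.+1) (qintSS _ b); ring.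
Qed.

(** The case q = 1, which shows that in characteristic zero no [[k]] with k > 0 vanishes as a
    polynomial in the loop value. *)
Lemma qint_minus2 (R : comNzRingType) k : qint (- 2%:R : R) k = k%:R.
Proof.
elim/ltn_ind: k => -[|[|k]] IHk //.
by rewrite qintSS !IHk // -[k.+2]addn2 -[k.+1]addn1 !natrD; ring.
Qed.

(** * Nondegeneracy on the walls *)

Section Valuation.
Variables (K : numFieldType) (d : K).
Local Notation Q := (qint ('X : {poly K})).
Local Notation G := (gram_mx ('X : {poly K})).

Lemma qint_neq0 k : (0 < k)%N -> Q k != 0.
Proof.
move=> k_gt0; apply: contraTneq (k_gt0) => Q0.
have := qint_map (horner_eval (- 2%:R : K)) 'X k.
rewrite Q0 rmorph0 /= /horner_eval hornerX qint_minus2 => /esym/eqP.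
by rewrite pnatr_eq0 => /eqP->.
Qed.

Lemma det_gram_neq0 n s : \det (G n s) != 0.
Proof.
elim: n s => [|n IHn] [|s]; rewrite ?det_gram_base ?det_gram_void ?oner_neq0 //.
have := det_gram_rec ('X : {poly K}) n s; apply: contra_eq_neq => ->.
by rewrite mul0r eq_sym !mulf_neq0 ?expf_neq0 ?oppr_eq0 ?qint_neq0.
Qed.

Lemma mup1 : mup d (1 : {poly K}) = 0%N.
Proof. by rewrite mupNroot // root1. Qed.

Lemma mupX (p : {poly K}) k : p != 0 -> mup d (p ^+ k) = (k * mup d p)%N.
Proof.
move=> p0; elim: k => [|k IHk]; first by rewrite mup1.
by rewrite exprS mupM ?expf_neq0 // IHk mulSn.
Qed.

Lemma mupN (p : {poly K}) : mup d (- p) = mup d p.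
Proof.
rewrite -mulN1r mupMr // -[-1]/(- 1%:P) -polyCN rootC oppr_eq0; exact: oner_neq0.
Qed.

Let nu k : int := Posz (mup d (Q k)).
Let v n s : int := Posz (mup d (\det (G n s))).

Lemma mup_det_rec n s :
  v n.+1 s.+1 = v n s + v n s.+2 + (ballot n s.+2)%:Z * (nu s.+2 - nu s.+1).
Proof.
have := congr1 (mup d) (det_gram_rec ('X : {poly K}) n s).
have Q1 : Q s.+1 != 0 by exact: qint_neq0.
have Q2 : - Q s.+2 != 0 by rewrite oppr_eq0; exact: qint_neq0.
rewrite !mupM ?mulf_neq0 ?expf_neq0 ?det_gram_neq0 // !mupX // mupN => e.
have := congr1 Posz e; rewrite !PoszD !PoszM /v /nu; lia.
Qed.

(* The valuation of prod_(j > 0) ([[s+j]] / [[j]]) ^ dim W_(s-1+2j)(n). *)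
Lemma mup_det n s J : (n <= J)%N ->
  v n s = \sum_(j < J) (ballot n (s + 2 * j.+1))%:Z * (nu (s + j.+1)%N - nu j.+1).
Proof.
elim: n s => [|n IHn] [|s] nJ.
- rewrite /v det_gram_void big1 => [|j _]; first by rewrite mup1.
  by rewrite subrr mulr0.
- rewrite /v det_gram_base big1 => [|j _]; first by rewrite mup1.
  by rewrite ballot_gt ?mul0r //; lia.
- rewrite /v det_gram_void big1 => [|j _]; first by rewrite mup1.
  by rewrite subrr mulr0.
(* The extra term of the recursion is b 0. As b J = 0, it is minus the telescoping sum of b (j+1) -
   b j, and adding this termwise shifts the indices. *)
pose a j : int := (ballot n (s + 2 * j.+1))%:Z.
pose b (j : nat) : int := a j * (nu (s + j.+2)%N - nu (s + j.+1)%N).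
rewrite mup_det_rec !IHn; try lia.
have -> : (ballot n s.+2)%:Z * (nu s.+2 - nu s.+1) = b 0%N.
  by rewrite /b /a muln1 !addnS addn0.
have aJ : a J = 0 by rewrite /a ballot_gt //; lia.
have bJ : b J = 0 by rewrite /b aJ mul0r.
have tele : \sum_(j < J) (b j.+1 - b j) = - b 0%N.
  by rewrite -(big_mkord xpredT (fun j => b j.+1 - b j)) telescope_sumr // bJ sub0r.
rewrite -[b 0%N]opprK -tele -sumrN -!big_split /=; apply: eq_bigr => j _.
have -> : (ballot n (s.+2 + 2 * j.+1))%:Z = a j.+1.
  by rewrite /a; congr (Posz (ballot _ _)); lia.
have -> : (ballot n.+1 (s.+1 + 2 * j.+1))%:Z = a j + a j.+1.
  rewrite /a -PoszD; congr Posz; rewrite addSn /=.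
  by congr (_ + ballot _ _)%N; lia.
rewrite -/(a j) /b !addSnnS; ring.
Qed.
End Valuation.

(** * Quantum integers and walls at a root of unity *)

Section RootOfUnity.
Variables (K : numFieldType) (q : K) (l : nat).
Hypotheses (q_neq0 : q != 0) (l_gt1 : (1 < l)%N) (ord_q : l.-primitive_root (q ^+ 2)).
Local Notation d := (loop_value q).
Local Notation Q := (qint ('X : {poly K})).

Lemma q_sub_inv_neq0 : q - q^-1 != 0.
Proof.
apply: contraTneq l_gt1 => /eqP; rewrite subr_eq0 => /eqP e.
have : (l %| 1)%N by rewrite (prim_order_dvd ord_q) expr1 expr2 {2}e divff.
by rewrite dvdn1 => /eqP->.
Qed.

Lemma qint_loop_value k : (q - q^-1) * qint d k = q ^+ k - q^-1 ^+ k.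
Proof.
elim/ltn_ind: k => -[|[|k]] IHk; first by rewrite mulr0 !expr0 subrr.
  by rewrite mulr1 !expr1.
rewrite qintSS mulrBr mulrCA !IHk // /loop_value opprK !exprSr.
have qq : q * q^-1 = 1 by rewrite divff.
have -> : (q + q^-1) * (q ^+ k * q - q^-1 ^+ k * q^-1) - (q ^+ k - q^-1 ^+ k) =
  q ^+ k * q * q - q^-1 ^+ k * q^-1 * q^-1 + (q ^+ k - q^-1 ^+ k) * (q * q^-1 - 1).
  by ring.
by rewrite qq subrr mulr0 addr0.
Qed.

(** [[k]] vanishes exactly when q^k = q^-k, that is, q^(2k) = 1. *)
Lemma qint_loop_value_eq0 k : (qint d k == 0) = (l %| k)%N.
Proof.
rewrite -(inj_eq (mulfI q_sub_inv_neq0)) qint_loop_value mulr0 subr_eq0.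
rewrite (prim_order_dvd ord_q) -exprM mulnC exprM -[LHS](inj_eq (mulIf (expf_neq0 k q_neq0))).
by rewrite -[q^-1 ^+ k * _]exprMn mulVf // expr1n expr2.
Qed.

Lemma root_qint k : root (Q k) d = (l %| k)%N.
Proof.
have e : horner_eval d 'X = d by rewrite /horner_eval hornerX.
by rewrite /root -[(Q k).[d]]/(horner_eval d (Q k)) qint_map /= e qint_loop_value_eq0.
Qed.

(* At [q] the quotient [[m l]]/[[l]] specialises to [m] up to a sign, which is
   where characteristic zero enters. *)
Lemma qint_mul_order m : exists2 r : {poly K},
  Q (m.+1 * l) = Q l * r & r.[d] = m.+1%:R * (q ^+ l) ^+ m.
Proof.
have e2 : (q ^+ l) ^+ 2 = 1 by rewrite -exprM mulnC exprM prim_expr_order.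
have eV : q^-1 ^+ l = q ^+ l.
  apply: (mulIf (expf_neq0 l q_neq0)); rewrite -exprMn mulVf // expr1n.
  by rewrite -expr2 e2.
have ev k : (Q k).[d] = qint d k.
  have e : horner_eval d 'X = d by rewrite /horner_eval hornerX.
  by rewrite -[(Q k).[d]]/(horner_eval d (Q k)) qint_map /= e.
elim: m => [|m [r rE rd]].
  by exists 1; [rewrite mul1n mulr1 | rewrite hornerC expr0 mulr1].
(* The addition formula writes [[(m+2)l]] as [[(m+1)l]] [[l+1]] - [[(m+1)l - 1]] [[l]], and [[l]]
   divides both terms. *)
exists (r * Q l.+1 - Q (m.+1 * l).-1).
  have ml_gt0 : (0 < m.+1 * l)%N by rewrite muln_gt0; lia.
  have -> : (m.+2 * l = ((m.+1 * l).-1 + l).+1)%N by rewrite mulSn; lia.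
  by rewrite qint_addition prednK // rE; ring.
rewrite hornerD hornerN hornerM rd !ev.
have -> : qint d l.+1 = q ^+ l.
  apply: (mulfI q_sub_inv_neq0); rewrite qint_loop_value !exprSr eV; ring.
have -> : qint d (m.+1 * l).-1 = - (q ^+ l) ^+ m.+1.
  apply: (mulfI q_sub_inv_neq0); rewrite qint_loop_value.
  have ml_gt0 : (0 < m.+1 * l)%N by rewrite muln_gt0; lia.
  have pred k (x : K) : x != 0 -> (0 < k)%N -> x ^+ k.-1 = x^-1 * x ^+ k.
    by move=> x0; case: k => // k _; rewrite exprS mulKf.
  rewrite !pred ?invr_eq0 // invrK mulnC !exprM eV; ring.
by rewrite exprS -[m.+2]addn1 natrD; ring.
Qed.

Lemma mup_qint k : (0 < k)%N ->
  mup d (Q k) = if (l %| k)%N then mup d (Q l) else 0%N.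
Proof.
move=> k_gt0; case: ifPn => [/dvdnP[[|m] kE]|ldk].
- by rewrite kE in k_gt0.
- have [r rE rd] := qint_mul_order m; rewrite kE rE mupMl //.
  rewrite /root rd mulf_neq0 ?pnatr_eq0 // !expf_neq0 //.
by rewrite mupNroot // root_qint.
Qed.

(** As [l] divides s, it divides s+j exactly when it divides j. All differences in [mup_det] vanish,
    so the loop value is not a root of the determinant. *)
Lemma rank_gram_wall n s : (l %| s)%N -> \rank (gram_mx d n s) = ballot n s.
Proof.
move=> lds; apply/eqP; rewrite -/(row_free _) row_free_unit unitmxE unitfE.
have e : horner_eval d 'X = d by rewrite /horner_eval hornerX.
have -> : gram_mx d n s = map_mx (horner_eval d) (gram_mx 'X n s).
  by rewrite gram_mx_map /= e.
rewrite det_map_mx -[horner_eval d _ != 0]/(~~ root (\det (gram_mx 'X n s)) d).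
have : Posz (mup d (\det (gram_mx 'X n s))) = 0.
  rewrite (mup_det _ _ (leqnn n)) big1 // => j _.
  have -> : mup d (Q (s + j.+1)%N) = mup d (Q j.+1); last by rewrite subrr mulr0.
  have sj : (0 < s + j.+1)%N by rewrite addnS.
  by rewrite (mup_qint sj) (mup_qint (ltn0Sn j)) dvdn_addr.
case=> mup0; have := mup_ltn d 1 (det_gram_neq0 K n s).
by rewrite mup0 expr1 dvdp_XsubCl => <-.
Qed.

Lemma rank_gram_order n s : ~~ (l %| s.+1)%N ->
  \rank (gram_mx d n.+1 s.+1) =
  (\rank (gram_mx d n s) + ~~ (l %| s.+2) * \rank (gram_mx d n s.+2))%N.
Proof.
move=> lds; rewrite rank_gram_rec qint_loop_value_eq0 ?qint_loop_value_eq0 //.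
Qed.
End RootOfUnity.

(** * Dimensions of the cell modules and of their heads *)

Lemma bdry_posE t n (x : points t n) : bdry_pos x = ((n + t).-1 - pos x)%N.
Proof. by case: x => [a|j] /=; [have := ltn_ord a | have := ltn_ord j]; lia. Qed.

Section WalkDiagram.
Variables t n : nat.

Lemma pairing_of_monic m : matching (n + t) m -> through n t m ->
  TL_diagram (pairing_of t n m) && monic_pairing (pairing_of t n m).
Proof.
move=> mM thr; apply/andP; split; last first.
  apply/forallP => a; case E : (pairing_of t n m (inl a)) => [b|j] //.
  have := pos_pairing_of (inl a) mM; rewrite E /= => e.
  have := thr (n + rev_ord a)%N; have := ltn_ord (rev_ord a); rewrite -e /=; lia.
apply/and3P; split.
- by apply/forallP => x; rewrite pairing_of_involutive.
- by apply/forallP => x; exact: pairing_of_neq.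
apply/forallP => x; apply/forallP => y; rewrite !bdry_posE !pos_pairing_of //.
have xN := pos_lt x; have yN := pos_lt y.
have := matching_lt mM xN; have := matching_lt mM yN => myN mxN.
have := matching_nest mM myN mxN; rewrite (matchingK mM yN) (matchingK mM xN).
by move=> H; apply/negP => /and3P[]; lia.
Qed.

Definition walk_diagram (k : 'I_(ballot n t.+1)) : monic_diagram t n :=
  Sub (pairing_of t n (walk_matching k))
    (pairing_of_monic (walk_matchingP k).1 (walk_matchingP k).2).

Lemma walk_diagram_inj : injective walk_diagram.
Proof.
move=> k k' /(congr1 val) /= /pairing_of_inj H; apply: walk_matching_inj; apply: H.
  exact: (walk_matchingP k).1.
exact: (walk_matchingP k').1.
Qed.

Lemma pairing_matching (D : pairing t n) : TL_diagram D -> monic_pairing D ->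
  exists m, [/\ matching (n + t) m, through n t m & pairing_of t n m = D].
Proof.
move=> /and3P[/forallP Di /forallP Dn /forallP nc] /forallP mon.
(* The default 0 is only reached for k >= n+t, where values do not matter. *)
pose m k := if [pick x : points t n | pos x == k] is Some x then pos (D x) else 0%N.
have mE x : m (pos x) = pos (D x).
  rewrite /m; case: pickP => [y /eqP/pos_inj-> //|/(_ x)]; by rewrite eqxx.
have DK x : D (D x) = x by apply/eqP.
have mM : matching (n + t) m.
  split=> [_ /pos_surj[x <-]|_ /pos_surj[x <-]|_ /pos_surj[x <-]|].
  - by rewrite mE pos_lt.
  - by rewrite !mE DK.
  - by rewrite mE => /pos_inj/eqP; apply/negP.
  move=> _ _ /pos_surj[x <-] /pos_surj[y <-]; rewrite !mE => /andP[xy yDx].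
  have neq1 : pos (D y) <> pos x.
    by move=> /pos_inj e; move: yDx; rewrite -e DK ltnn.
  have neq2 : pos (D y) <> pos (D x).
    by move=> /pos_inj/(congr1 D); rewrite !DK => e; move: xy; rewrite e ltnn.
  have := forallP (nc (D x)) y; have := forallP (nc (D y)) (D x).
  rewrite !bdry_posE !DK.
  have := pos_lt x; have := pos_lt y; have := pos_lt (D x); have := pos_lt (D y).
  move: (pos x) (pos y) (pos (D x)) (pos (D y)) xy yDx neq1 neq2 => a b c e.
  clear => *.
  lia.
exists m; split=> //.
  move=> k /andP[nk kN]; have [x xk] := pos_surj kN.
  rewrite -xk mE; case: x xk => [a|j] xk; last by have := ltn_ord j; rewrite /= in xk; lia.
  by have := mon a; case: (D (inl a)) => [//|j] _; exact: ltn_ord j.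
by apply/ffunP => x; apply: pos_inj; rewrite pos_pairing_of // mE.
Qed.

Lemma walk_diagram_surj D : exists k, walk_diagram k = D.
Proof.
have /andP[TD mD] := valP D.
have [m [mM thr mD']] := pairing_matching TD mD.
have [k km] := walk_matching_surj mM thr; exists k; apply: val_inj => /=.
by rewrite -mD'; apply: eq_pairing_of.
Qed.

Lemma walk_diagram_bij : bijective walk_diagram.
Proof.
apply: inj_card_bij walk_diagram_inj _.
rewrite -(card_codom walk_diagram_inj); apply/subset_leq_card/subsetP => D _.
by have [k <-] := walk_diagram_surj D; rewrite codom_f.
Qed.

Section Dim.
Variables (K : fieldType) (q : K).

Let G := gram_mx (loop_value q) n t.+1.
Definition cell_row (u : cell K t n) : 'rV[K]_(ballot n t.+1) :=
  \row_k u (walk_diagram k).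

Lemma cell_formE u v : cell_form q u v = (cell_row u *m G *m (cell_row v)^T) 0 0.
Proof.
rewrite /cell_form (reindex _ (onW_bij _ walk_diagram_bij)) mxE exchange_big /=.
rewrite (reindex _ (onW_bij _ walk_diagram_bij)); apply: eq_bigr => k _.
rewrite !mxE big_distrl /=; apply: eq_bigr => j _; rewrite !mxE mulrAC.
by [].
Qed.

Lemma cell_row_linear : linear cell_row.
Proof. by move=> a u v; apply/rowP => k; rewrite !mxE !ffunE. Qed.

Lemma cell_row_surj (r : 'rV[K]_(ballot n t.+1)) : exists u, cell_row u = r.
Proof.
have [f fK Kf] := walk_diagram_bij.
by exists [ffun D => r 0 (f D)]; apply/rowP => k; rewrite mxE ffunE fK.
Qed.

HB.instance Definition _ :=
  GRing.isLinear.Build K (cell K t n) 'rV[K]_(ballot n t.+1) _ cell_row cell_row_linear.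

Lemma dim_cell : \dim {:cell K t n} = ballot n t.+1.
Proof.
rewrite -(limg_ker_dim (linfun cell_row) fullv) capfv.
have /eqP-> : lker (linfun cell_row) == 0%VS.
  apply/lker0P => u v; rewrite !lfunE /= => /rowP e; apply/ffunP => D.
  by have [k <-] := walk_diagram_surj D; have := e k; rewrite !mxE.
have -> : limg (linfun cell_row) = fullv.
  apply/vspaceP => r; rewrite memvf; have [u <-] := cell_row_surj r.
  by rewrite -[cell_row u](lfunE _ u) memv_img ?memvf.
by rewrite dimv0 add0n dimvf dim_matrix; exact: mul1n.
Qed.

Definition cell_gram (u : cell K t n) : 'rV[K]_(ballot n t.+1) := cell_row u *m G.
Lemma cell_gram_linear : linear cell_gram.
Proof.
by move=> a u v; rewrite /cell_gram cell_row_linear mulmxDl scalemxAl.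
Qed.
HB.instance Definition _ :=
  GRing.isLinear.Build K (cell K t n) 'rV[K]_(ballot n t.+1) _ cell_gram cell_gram_linear.

Lemma cell_rad_ker : cell_rad q t n = lker (linfun cell_gram).
Proof.
apply/vspaceP => u; rewrite [RHS]memv_ker [in RHS]lfunE /=.
apply/cell_radP/eqP => [u0|u0 v]; last first.
  by rewrite cell_formE -[_ *m G]/(cell_gram u) u0 mul0mx mxE.
apply/rowP => k; have [v ve] := cell_row_surj (delta_mx 0 k).
have := u0 v; rewrite cell_formE ve trmx_delta -[_ *m G]/(cell_gram u).
by rewrite -colE !mxE.
Qed.

(** The radical is the kernel of [cell_gram], so the quotient has the dimension of its image, the
    row space of G. *)
Lemma dim_cell_head : \dim {:cell_head q t n} = \rank G.
Proof.
have := dim_vquot (cell_rad q t n); rewrite cell_rad_ker.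
rewrite -(limg_ker_dim (linfun cell_gram) fullv) capfv addnC => /addnI ->.
(* An injective parametrisation of the row space, whose source has dimension the rank of G. *)
pose g := linfun (mulmxr (row_base G)) : 'Hom('rV[K]_(\rank G), 'rV[K]_(ballot n t.+1)).
have -> : (linfun cell_gram @: fullv = limg g)%VS.
  apply/vspaceP => v; apply/memv_imgP/memv_imgP => -[u _ ->].
    rewrite lfunE /= /cell_gram.
    have /submxP[w wE] : (cell_row u *m G <= row_base G)%MS.
      by rewrite eq_row_base submxMl.
    by exists w; rewrite ?memvf // lfunE /= wE.
  rewrite lfunE /=.
  have /submxP[w wE] : (u *m row_base G <= G)%MS by rewrite mulmx_sub // eq_row_base.
  have [u' u'w] := cell_row_surj w.
  by exists u'; rewrite ?memvf // lfunE /= /cell_gram u'w wE.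
have := limg_ker_dim g fullv; rewrite capfv.
have /eqP-> : lker g == 0%VS.
  apply/lker0P => u v; rewrite !lfunE /= => e.
  by apply: (row_free_inj (row_base_free G)).
by rewrite dimv0 add0n => ->; rewrite dimvf dim_matrix; exact: mul1n.
Qed.
End Dim.
End WalkDiagram.

(** * Generating functions *)

Section Series.
Variable F : fieldType.
Implicit Types (f g : fps F) (A B : nat -> fps F).

Definition fps_x : fps F := Fps (fun n => (n == 1%N)%:R).

Lemma coef_xM0 f : fps_coef (fps_x * f) 0 = 0.
Proof. by rewrite fps_coefM0 mul0r. Qed.

Lemma coef_xMS f k : fps_coef (fps_x * f) k.+1 = fps_coef f k.
Proof.
rewrite fps_coefM big_ord_recl mul0r add0r big_ord_recl mul1r subn1 /= big1 ?addr0 //.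
by move=> i _; rewrite mul0r.
Qed.

(** The coefficient of x^k in the term s+1 depends on that of x^k in the term s and of x^(k-1) in
    the term s+2: induct on k, then on s. *)
Lemma ladder_uniq A B : A 0%N = B 0%N ->
  (forall s, A s.+1 = A s + fps_x * A s.+2) ->
  (forall s, B s.+1 = B s + fps_x * B s.+2) -> A =1 B.
Proof.
move=> AB0 HA HB s; apply/fpsP => k; elim: k s => [|k IHk]; elim=> [|s IHs].
- by rewrite AB0.
- by rewrite HA HB !fps_coefD !coef_xM0 IHs.
- by rewrite AB0.
by rewrite HA HB !fps_coefD !coef_xMS IHs IHk.
Qed.

(** For fixed r, the shift of A by r and the product of A with [A r] solve the same recursion with
    the same initial term. By uniqueness A is multiplicative. *)
Lemma ladder_exp A : A 0%N = 1 -> (forall s, A s.+1 = A s + fps_x * A s.+2) ->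
  forall s, A s = A 1%N ^+ s.
Proof.
move=> A0 HA.
have mulA r s : A (s + r)%N = A s * A r.
  apply: (@ladder_uniq (fun s => A (s + r)%N) (fun s => A s * A r)) => [|{}s|{}s].
  - by rewrite A0 mul1r.
  - by rewrite !addSn HA.
  - by rewrite HA mulrDl mulrA.
by elim=> [|s IHs]; rewrite ?A0 // -addn1 mulA IHs addn1 exprSr.
Qed.
End Series.

(** The reflection principle, C(n, k) - C(n, k-1), stated additively; it follows from the rule of
    Pascal. *)
Lemma ballot_bin n s k : n.+1 = (s + 2 * k)%N ->
  (ballot n s + (if k is k'.+1 then 'C(n, k') else 0) = 'C(n, k))%N.
Proof.
elim: n s k => [|n IHn] s k e.
  by case: k s e => [|k] [|[|s]] //=; lia.
case: s e => [|s] e.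
  case: k e => [|k] e; first by lia.
  have -> : n.+1 = (k + k.+1)%N by lia.
  by rewrite ballot0 add0n -[LHS](bin_sub (leq_addr _ _)) addKn.
have e1 : n.+1 = (s + 2 * k)%N by lia.
have := IHn _ _ e1; rewrite [ballot n.+1 s.+1]/=.
case: k e e1 => [|k] e e1.
  by rewrite !bin0 (@ballot_gt n s.+2); lia.
have e2 : n.+1 = (s.+2 + 2 * k)%N by lia.
have := IHn _ _ e2; case: k {e e1 e2} => [|k]; rewrite !binS ?bin0; lia.
Qed.

Lemma catalan_ballot k :
  (k.+1%:R)^-1 * 'C(2 * k, k)%:R = (ballot (2 * k) 1)%:R :> rat.
Proof.
have e : (2 * k).+1 = (1 + 2 * k)%N by lia.
have H : (k.+1 * ballot (2 * k) 1 = 'C(2 * k, k))%N.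
  have := ballot_bin e; case: k {e} => [|k]; first by rewrite muln0 bin0; lia.
  have := mul_bin_left (2 * k.+1) k.
  have -> : (2 * k.+1 - k = k.+2)%N by lia.
  by move: (ballot _ _) ('C(_, k.+1)) ('C(_, k)); lia.
by rewrite -H natrM mulKf // pnatr_eq0.
Qed.

(** The value 1 at s = 0 makes the recursion hold there: it supplies the empty diagram, the constant
    term at s = 1. *)
Definition ballot_series (s : nat) : fps rat :=
  if s is t.+1 then Fps (fun k => (ballot (t + 2 * k) t.+1)%:R) else 1.

Lemma coef_ballot_series t k :
  fps_coef (ballot_series t.+1) k = (ballot (t + 2 * k) t.+1)%:R.
Proof. by []. Qed.

Lemma ballotS n s : ballot n.+1 s.+1 = (ballot n s + ballot n s.+2)%N.
Proof. by []. Qed.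

Lemma ballot_ladder s :
  ballot_series s.+1 = ballot_series s + fps_x rat * ballot_series s.+2.
Proof.
apply/fpsP => -[|k]; rewrite fps_coefD ?coef_xM0 ?coef_xMS coef_ballot_series.
  case: s => [|s]; first by rewrite addr0 muln0.
  by rewrite coef_ballot_series !muln0 !addn0 ballotS (@ballot_gt s s.+3) // addn0 addr0.
rewrite coef_ballot_series; case: s => [|s].
  have -> : (0 + 2 * k.+1 = (1 + 2 * k).+1)%N by lia.
  by rewrite fps_coef1 add0r ballotS ballot0 add0n.
have -> : (s.+1 + 2 * k.+1 = (s + 2 * k.+1).+1)%N by lia.
have -> : (s.+2 + 2 * k = s + 2 * k.+1)%N by lia.
by rewrite coef_ballot_series ballotS natrD.
Qed.

Lemma catalan_seriesE : catalan_series = ballot_series 1.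
Proof. by apply/fpsP => k /=; rewrite catalan_ballot. Qed.

Lemma ballot_series_exp s : ballot_series s = catalan_series ^+ s.
Proof. by rewrite catalan_seriesE; apply: ladder_exp => // r; exact: ballot_ladder. Qed.

Lemma catalan_quadratic : catalan_series = 1 + fps_x rat * catalan_series ^+ 2.
Proof. by rewrite -ballot_series_exp {1}catalan_seriesE ballot_ladder. Qed.

Lemma cell_seriesE (K : fieldType) t : cell_series K t = catalan_series ^+ t.+1.
Proof.
by rewrite -ballot_series_exp; apply/fpsP => k /=; rewrite dim_cell.
Qed.

(** * The series of the heads *)

Section HeadSeries.
Variables (K : numFieldType) (q : K) (l : nat).
Hypotheses (q_neq0 : q != 0) (l_gt1 : (1 < l)%N) (ord_q : l.-primitive_root (q ^+ 2)).
Local Notation c := catalan_series.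
Local Notation d := (c - 1).

Definition rank_series (s : nat) : fps rat :=
  if s is t.+1 then
    Fps (fun k => (\rank (gram_mx (loop_value q) (t + 2 * k) t.+1))%:R)
  else 1.

Lemma coef_rank_series t k : fps_coef (rank_series t.+1) k =
  (\rank (gram_mx (loop_value q) (t + 2 * k) t.+1))%:R.
Proof. by []. Qed.

Lemma rank_series_wall s : (l %| s)%N -> rank_series s = c ^+ s.
Proof.
move=> ls; rewrite -ballot_series_exp; case: s ls => [//|s] ls.
by apply/fpsP => k /=; rewrite (rank_gram_wall q_neq0 l_gt1 ord_q).
Qed.

Lemma rank_series_ladder s : ~~ (l %| s.+1)%N -> rank_series s.+1 =
  rank_series s + fps_x rat * (if (l %| s.+2)%N then 0 else rank_series s.+2).
Proof.
move=> ls.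
have rec := rank_gram_order q_neq0 l_gt1 ord_q _ ls.
have small n r : ballot n r = 0%N -> \rank (gram_mx (loop_value q) n r) = 0%N.
  by move=> n0; apply/eqP; rewrite -leqn0 -n0 rank_leq_row.
apply/fpsP => -[|k]; rewrite fps_coefD ?coef_xM0 ?coef_xMS coef_rank_series.
  rewrite addr0; case: s ls rec => [|s] ls rec.
    by rewrite muln0 mxrank_unit // unitmxE det_gram_base unitr1.
  rewrite coef_rank_series !muln0 !addn0 rec (small _ s.+3) ?muln0 ?addn0 //.
  by rewrite ballot_gt.
have -> : fps_coef (if (l %| s.+2)%N then 0 else rank_series s.+2) k =
    (~~ (l %| s.+2) * \rank (gram_mx (loop_value q) (s.+1 + 2 * k) s.+2))%N%:R.
  by case: ifP => _; rewrite ?mul0n // mul1n.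
case: s ls rec => [|s] ls rec.
  have -> : (0 + 2 * k.+1 = (1 + 2 * k).+1)%N by lia.
  by rewrite fps_coef1 add0r rec (small _ 0%N) ?ballot0 // add0n.
have -> : (s.+1 + 2 * k.+1 = (s + 2 * k.+1).+1)%N by lia.
have -> : (s.+2 + 2 * k = s + 2 * k.+1)%N by lia.
by rewrite coef_rank_series rec natrD.
Qed.

Lemma d_eq : d = fps_x rat * c ^+ 2.
Proof. by rewrite {1}catalan_quadratic addrC addKr. Qed.

Lemma unit_1subd e : (0 < e)%N -> (1 - d ^+ e) \is a GRing.unit.
Proof.
by move=> e_gt0; rewrite unfold_in /= /fps_unit fps_coefD fps_coefN fps_coefX_small //.
Qed.

(** The claimed series for t = s - 1. If [l] divides s, the exponent is [l] and the fraction
    cancels, so one formula covers the walls too. *)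
Definition head_gf (s : nat) : fps rat :=
  c ^+ s * (1 - d ^+ (l - s %% l)) / (1 - d ^+ l).

Lemma head_gf_wall s : (l %| s)%N -> head_gf s = c ^+ s.
Proof.
by move=> /eqP ls; rewrite /head_gf ls subn0 mulrK // unit_1subd // ltnW.
Qed.

(** With c = 1 + d and x c^2 = d this becomes (1 + d)(1 - d^(e+1)) = (1 - d^(e+2)) + d (1 - d^e).
    Just below a wall e = 0, and the last term drops out. *)
Lemma head_gf_ladder s : ~~ (l %| s.+1)%N -> head_gf s.+1 =
  head_gf s + fps_x rat * (if (l %| s.+2)%N then 0 else head_gf s.+2).
Proof.
move=> ls.
have b_gt0 : (0 < s.+1 %% l)%N by rewrite lt0n.
have b_lt : (s.+1 %% l < l)%N by rewrite ltn_mod ltnW.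
have s_mod : (s %% l = (s.+1 %% l).-1)%N.
  have := modnS s l; case: ifP => [|_ ->]; first by move: ls => /[swap] ->.
  by [].
have s2_mod : (s.+2 %% l = if l %| s.+2 then 0 else (s.+1 %% l).+1)%N.
  exact: modnS.
have xc : fps_x rat * c ^+ s.+2 = d * c ^+ s.
  by rewrite d_eq -addn2 exprD; ring.
have c1 : c = 1 + d by rewrite addrC subrK.
rewrite /head_gf s_mod; case: ifP s2_mod => l2 s2_mod.
  have bE : (s.+1 %% l = l.-1)%N.
    have : (l %| (s.+1 %% l).+1)%N.
      by rewrite /dvdn -addn1 modnDml addn1; exact: l2.
    move=> /dvdn_leq; lia.
  rewrite mulr0 addr0 bE; apply: (congr1 (fun z => z * _)).
  have -> : (l - l.-1 = 1)%N by lia.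
  have -> : (l - l.-1.-1 = 2)%N by lia.
  by rewrite exprS {1}c1; ring.
rewrite (mulrA (fps_x rat)) (mulrA (fps_x rat) (c ^+ s.+2)) xc s2_mod -mulrDl.
apply: (congr1 (fun z => z * _)).
have b2 : ((s.+1 %% l).+1 < l)%N.
  rewrite ltn_neqAle b_lt andbT; apply: contraFneq l2 => e.
  by rewrite /dvdn -addn1 -modnDml addn1 e modnn.
have [e eE] : exists e, (l - (s.+1 %% l).+1 = e)%N by exists (l - (s.+1 %% l).+1)%N.
have -> : (l - s.+1 %% l = e.+1)%N by lia.
have -> : (l - (s.+1 %% l).-1 = e.+2)%N by lia.
rewrite eE exprS {1}c1 !exprS.
by move: (c ^+ s) (c - 1) (_ ^+ e) => *; ring.
Qed.

Lemma rank_seriesE s : rank_series s = head_gf s.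
Proof.
apply/fpsP => k; elim/ltn_ind: k s => k IHk; elim=> [|s IHs].
  by rewrite head_gf_wall.
have [ls|ls] := boolP (l %| s.+1)%N.
  by rewrite rank_series_wall ?head_gf_wall.
rewrite rank_series_ladder // head_gf_ladder // !fps_coefD IHs.
case: k IHk {IHs} => [|k] IHk; first by rewrite !coef_xM0.
by rewrite !coef_xMS; case: ifP => // _; rewrite IHk.
Qed.

Lemma cell_head_seriesE t : cell_head_series q t = rank_series t.+1.
Proof. by apply/fpsP => k /=; rewrite dim_cell_head. Qed.
End HeadSeries.

Theorem theorem6p2 (R : realType) (q : R[i]) (l t a b : nat) (hq : q != 0)
    (hl : (4 <= l)%N) (hord : l.-primitive_root (q ^+ 2))
    (ht : t = (a * l + b)%N) (hb : (b <= l - 1)%N) :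
  let c := catalan_series in
  let d := c - 1 in
  (b = (l - 1)%N ->
     cell_head_series q t = cell_series R[i] t /\
     cell_series R[i] t = c ^+ t.+1) /\
  ((b <= l - 2)%N ->
     cell_head_series q t
     = ((d + 1) ^+ t.+1 * (1 - d ^+ (l - 1 - b))) / (1 - d ^+ l)).
Proof.
have l_gt1 : (1 < l)%N by lia.
move=> c d; rewrite cell_head_seriesE; split=> bE.
  have lt1 : (l %| t.+1)%N.
    have -> : (t.+1 = a * l + l)%N by lia.
    by rewrite dvdn_addr // dvdn_mull.
  by rewrite cell_seriesE (rank_series_wall hq l_gt1 hord).
rewrite (rank_seriesE hq l_gt1 hord) /head_gf /d subrK.
have -> : (t.+1 %% l = b.+1)%N.
  by rewrite ht -addnS modnMDl modn_small //; lia.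
by have -> : (l - b.+1 = l - 1 - b)%N by lia.
Qed.
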